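(* Let $q$ be as described in the context and let $G(z)=\int_{-\infty}^{\infty} e^{-q(t)}e^{izt}\,dt$ for $z\in\mathbb{C}$. Then $G$ is an entire function all of whose zeros are real.
   Context: Let $q:\mathbb{R}\to\mathbb{R}$ be given by $q(t)=k\,t^{2m}e^{\mu t^2}\prod_n\left(1+t^2/\beta_n^2\right)$, where $k>0$, $\mu\ge 0$, $m$ is a positive integer, and $(\beta_n)$ is a finite or infinite sequence of nonzero real numbers with $\sum_n \beta_n^{-2}<\infty$ (the product is taken to be $1$ if there are no $\beta_n$). Assume moreover that there exist constants $T>0$ and $\alpha>0$ such that $q(t)>t^{2+\alpha}$ for all real $t\ge T$. *)

(* Defs.v *)
From Stdlib Require Import Reals Lra.
Open Scope R_scope.

Definition Cx := (R * R)%type.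
Definition Cadd (z w : Cx) : Cx := (fst z + fst w, snd z + snd w).
Definition Csub (z w : Cx) : Cx := (fst z - fst w, snd z - snd w).
Definition Cmul (z w : Cx) : Cx :=
  (fst z * fst w - snd z * snd w, fst z * snd w + snd z * fst w).
Definition Cnorm (z : Cx) : R := sqrt (fst z ^ 2 + snd z ^ 2).

Definition entire (f : Cx -> Cx) : Prop :=
  forall z : Cx, exists d : Cx, forall eps : R, eps > 0 ->
    exists delta : R, delta > 0 /\
      forall h : Cx, 0 < Cnorm h < delta ->
        Cnorm (Csub (Csub (f (Cadd z h)) (f z)) (Cmul d h)) <= eps * Cnorm h.

Definition improper_int_R (f : R -> R) (l : R) : Prop :=
  (forall a b : R, inhabited (Riemann_integrable f a b)) /\
  forall eps : R, eps > 0 -> exists M : R,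
    forall (a b : R) (pr : Riemann_integrable f (- a) b),
      a > M -> b > M -> Rabs (RiemannInt pr - l) < eps.

(** The (complex) integral  int_R e^{-q(t)} e^{i z t} dt = l, split in real
    and imaginary parts: for z = x + i y,
    e^{-q(t)} e^{izt} = e^{-q(t) - y t} (cos (x t) + i sin (x t)). *)
Definition fourier_integral (q : R -> R) (z : Cx) (l : Cx) : Prop :=
  improper_int_R (fun t => exp (- q t - snd z * t) * cos (fst z * t)) (fst l) /\
  improper_int_R (fun t => exp (- q t - snd z * t) * sin (fst z * t)) (snd l).

(** Sequences (beta_n), finite or infinite: [Nb = None] means the sequence
    is infinite (indexed by all n), [Nb = Some L] means it is
    beta_0, ..., beta_{L-1} (L = 0 is the empty sequence). *)
Definition in_idx (Nb : option nat) (n : nat) : bool :=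
  match Nb with None => true | Some L => Nat.ltb n L end.

Fixpoint pprod (Nb : option nat) (beta : nat -> R) (N : nat) (t : R) : R :=
  match N with
  | O => 1
  | S n => pprod Nb beta n t *
           (if in_idx Nb n then 1 + t ^ 2 / (beta n) ^ 2 else 1)
  end.

Definition admissible_seq (Nb : option nat) (beta : nat -> R) : Prop :=
  (forall n, in_idx Nb n = true -> beta n <> 0) /\
  (exists s : R, Un_cv (fun N => sum_f_R0
       (fun n => if in_idx Nb n then / (beta n) ^ 2 else 0) N) s).

Definition is_q (k mu : R) (m : nat) (Nb : option nat) (beta : nat -> R)
    (q : R -> R) : Prop :=
  forall t : R,
    Un_cv (fun N => k * t ^ (2 * m) * exp (mu * t ^ 2) * pprod Nb beta N t) (q t).

(* Main.v *)
Require Import Defs.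
From Stdlib Require Import Reals Lra Lia List.
From mathcomp Require all_boot all_order all_algebra ring lra zify complex Rstruct.
From Coquelicot Require Import Coquelicot.
Open Scope R_scope.

(** The function [q] is approximated by even polynomials [q_N] with purely imaginary zeros,
    and [exp (- q)] on a grid of mesh [h] by weights with [w_0 = 1] and
    [w_j / w_(j-1) = (1 - A_j) / (1 + A_j)], where [A_j = (q_N (h j) - q_N (h (j-1))) / 2].
    The mesh is chosen so that [A_(N+1) = 1], hence the weights vanish beyond [N].
    Then [p(u) = sum_j w_|j| u^(j+N)] satisfies [(1 - u) p = - B(theta) ((1 + u) p)] with
    [theta = u d/du] and [B] a polynomial whose zeros lie on one vertical line; a
    Gauss-Lucas type argument puts all roots of [p] on the unit circle.  The symmetric sum
    [F(z) = sum_j w_|j| e^(i h j z)] is therefore a product of factors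
    [1 - s (2 - 2 cos (h z))] with [s >= 0], and [sum s] is controlled by [F(i) / F(0)].
    This gives a lower bound on [|F(z)|] for non-real [z] that survives the limit
    [h F -> G], so no Hurwitz theorem is needed. *)

(** * Self-inversive polynomials with unimodular roots *)

(** Across one mesh cell [exp (- q)] shrinks by [exp (-2 A)], which gives no polynomial identity.
    The Cayley factor [(1 - A) / (1 + A)] turns the step into [w_(j-1) - w_j = A_j (w_(j-1) + w_j)],
    linear in the weights with coefficients polynomial in j, and it vanishes at A = 1, so the sum is
    finite by itself. Evenness of q_N extends the recurrence to the symmetric weights w_|j|. The
    polynomial (q_N (h (z + 1/2)) - q_N (h (z - 1/2))) / 2, of which B is a translate, has imaginary
    zeros only: as the zeros of q_N are imaginary, the two values can agree in modulus only when Re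
    z = 0. This is where the special form of q enters. The number of factors is unbounded as the
    mesh shrinks, so the limit needs a bound on the whole product. For fixed non-real z the argument
    of 2 - 2 cos (h z) stays away from 0 uniformly in small h, hence the squared modulus of each
    factor is at least exp (- C h^2 s); and h^2 times the sum of the s is what the single evaluation
    at z = i bounds. *)

Module Alg.
Set Implicit Arguments. Unset Strict Implicit. Unset Printing Implicit Defensive.
Import all_boot all_order all_algebra ring lra zify complex.
Import Order.TTheory GRing.Theory Num.Theory.
Local Open Scope ring_scope.
Local Open Scope complex_scope.

Section UnitCircle.
Context {R : rcfType}.
Implicit Types (u z : R[i]) (f p : {poly R[i]}).

(** Squared modulus with values in the real field, whose order is total; the norm of [R[i]] takes
    its values in [R[i]] itself. *)
Definition nsq z : R := complex.Re z ^+ 2 + complex.Im z ^+ 2.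

Lemma nsqM u z : nsq (u * z) = nsq u * nsq z.
Proof. case: u z => [a b] [c d]; rewrite /nsq /=; ring. Qed.

Lemma nsq1 : nsq 1 = 1.
Proof. by rewrite /nsq /= expr1n expr0n /= addr0. Qed.

Lemma nsqN u : nsq (- u) = nsq u.
Proof. by case: u => a b; rewrite /nsq /= !sqrrN. Qed.

Lemma nsq_ge0 z : 0 <= nsq z.
Proof. by rewrite addr_ge0 ?sqr_ge0. Qed.

Lemma nsq_eq0 z : (nsq z == 0) = (z == 0).
Proof.
by rewrite eq_complex /= /nsq paddr_eq0 ?sqr_ge0 // !sqrf_eq0.
Qed.

Lemma nsq_gt0 z : (0 < nsq z) = (z != 0).
Proof. by rewrite lt_neqAle nsq_ge0 andbT eq_sym nsq_eq0. Qed.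

Lemma natC n : n%:R = n%:R%:C :> R[i].
Proof. by rewrite rmorph_nat. Qed.

Lemma half_natC n : n%:R / 2 = (n%:R / 2)%:C :> R[i].
Proof. by rewrite rmorphM fmorphV !rmorph_nat. Qed.

Lemma nsq_prod T (s : seq T) (F : T -> R[i]) :
  nsq (\prod_(r <- s) F r) = \prod_(r <- s) nsq (F r).
Proof. by elim: s => [|a s IH]; rewrite ?big_nil ?nsq1 // !big_cons nsqM IH. Qed.

Lemma Re_sum (s : seq R[i]) (F : R[i] -> R[i]) :
  complex.Re (\sum_(r <- s) F r) = \sum_(r <- s) complex.Re (F r).
Proof. by elim: s => [|a s IH]; rewrite ?big_nil // !big_cons -IH; case: (F a); case: (\sum_(_ <- _) _). Qed.

(** The map r -> u / (u - r) sends the circle |r| = |u| to the line Re = 1/2 and its interior to the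
    right of that line. *)
Lemma Re_div_sub u r : u != r ->
  complex.Re (u / (u - r)) = 2^-1 + (nsq u - nsq r) / (2 * nsq (u - r)).
Proof.
rewrite -subr_eq0 -nsq_eq0; case: u r => [a b] [c d]; rewrite /nsq /= => h.
field; exact: h.
Qed.

Lemma horner_deriv_prod_XsubC (s : seq R[i]) u :
  let p := \prod_(r <- s) ('X - r%:P) in
  u \notin s -> p^`().[u] = p.[u] * \sum_(r <- s) (u - r)^-1.
Proof.
elim: s => [|a s IH] /=; first by rewrite !big_nil derivC horner0 mulr0.
rewrite !big_cons inE negb_or => /andP[ua us].
have ua0 : u - a != 0 by rewrite subr_eq0.
rewrite derivM derivXsubC mul1r !hornerE (IH us); field; exact: ua0.
Qed.

(* [theta - n/2 - i eta] with [theta = X d/dX]. *)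
Definition rot (n : nat) (eta : R) f : {poly R[i]} :=
  'X * f^`() - (n%:R / 2 +i* eta) *: f.

Lemma coef_rot n eta f j :
  (rot n eta f)`_j = (j%:R - (n%:R / 2 +i* eta)) * f`_j.
Proof.
rewrite /rot coefB coefZ coefXM coef_deriv mulrBl; congr (_ - _).
by case: j => [|j]; rewrite ?mul0r //= mulr_natl.
Qed.

(** [rho] is a squared radius. Equal moduli of the extreme coefficients, a weak form of
    self-inversiveness, make the product of the moduli of the roots equal to 1. *)
Definition balanced n rho f :=
  [/\ size f = n.+1, nsq f`_0 = nsq f`_n & forall r, root f r -> nsq r <= rho].

Lemma balanced_roots n rho f : balanced n rho f ->
  exists s : seq R[i], [/\ f = lead_coef f *: \prod_(r <- s) ('X - r%:P),
    size s = n, \prod_(r <- s) nsq r = 1, lead_coef f != 0 &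
    forall r, r \in s -> nsq r <= rho].
Proof.
case=> sf cf rf; have [s fE] := closed_field_poly_normal f.
have f0 : f != 0 by rewrite -size_poly_eq0 sf.
have l0 : lead_coef f != 0 by rewrite lead_coef_eq0.
exists s; split=> //.
- by have := sf; rewrite fE size_scale // size_prod_XsubC => -[].
- have : nsq f.[0] = nsq (lead_coef f) by rewrite horner_coef0 cf lead_coefE sf.
  rewrite {1}fE hornerZ nsqM horner_prod nsq_prod.
  rewrite (eq_bigr nsq) => [h|r _]; last by rewrite hornerXsubC sub0r nsqN.
  by apply: (@mulfI _ (nsq (lead_coef f))); rewrite ?nsq_eq0 ?mulr1.
- by move=> r rs; apply: rf; rewrite fE rootZ // root_prod_XsubC.
Qed.

(* For |u| at least the root radius, each u/(u - r) has real part at least 1/2, and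
   the roots cannot all lie on the circle since their product is unimodular. *)
Lemma rot_not_root n rho eta f u : balanced n rho f -> 1 < rho -> (0 < n)%N ->
  rho <= nsq u -> ~~ root f u -> ~~ root (rot n eta f) u.
Proof.
move=> bf rho1 n0 ru fu.
have [s [fE ss ps l0 rs]] := balanced_roots bf.
have us : u \notin s by move: fu; rewrite fE rootZ // root_prod_XsubC.
have [r0 r0s r0rho] : exists2 r, r \in s & nsq r < rho.
  case: (boolP (has (fun r => nsq r < rho) s)) => [/hasP //|/hasPn hs].
  suff : 1 < \prod_(r <- s) nsq r by rewrite ps ltxx.
  have: (0 < size s)%N by rewrite ss.
  elim: (s) hs => [//|a t IH] hs _; rewrite big_cons.
  have ha : rho <= nsq a by rewrite leNgt; apply: hs; rewrite inE eqxx.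
  case: t IH hs => [|b t] IH hs; first by rewrite big_nil mulr1 (lt_le_trans rho1).
  have := IH (fun r rt => hs r (@mem_behead _ (a :: _) r rt)) isT.
  by apply: mulr_egt1; rewrite (lt_le_trans rho1).
have fu0 : f.[u] != 0 by [].
have dE : f^`().[u] = f.[u] * \sum_(r <- s) (u - r)^-1.
  by rewrite {1 2}fE derivZ !hornerZ horner_deriv_prod_XsubC // mulrA.
have ur r : r \in s -> u != r by apply: contraTneq => <-.
rewrite /root /rot !hornerE dE.
have -> : u * (f.[u] * \sum_(r <- s) (u - r)^-1) - (n%:R / 2 +i* eta) * f.[u]
  = f.[u] * (\sum_(r <- s) u / (u - r) - (n%:R / 2 +i* eta)).
  by rewrite -mulr_sumr; ring.
(* The real part alone is nonzero, and [eta] does not enter it: each of the n roots contributes at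
   least 1/2 against n/2, and [r0] contributes strictly more. *)
rewrite mulf_neq0 // eq_complex negb_and; apply/orP; left.
have -> : complex.Re (\sum_(r <- s) u / (u - r) - (n%:R / 2 +i* eta)) =
  \sum_(r <- s) complex.Re (u / (u - r)) - n%:R / 2.
  by rewrite -Re_sum; case: (\sum_(r <- s) _).
rewrite big_seq (eq_bigr (fun r => 2^-1 + (nsq u - nsq r) / (2 * nsq (u - r))));
  last by move=> r /ur h; rewrite Re_div_sub.
rewrite -big_seq.
rewrite big_split /= big_const_seq count_predT iter_addr_0 ss.
rewrite -[2^-1 *+ n]mulr_natl addrAC subrr add0r gt_eqF //.
have e0 r : r \in s -> 0 <= (nsq u - nsq r) / (2 * nsq (u - r)).
  by move=> h; rewrite divr_ge0 ?mulr_ge0 ?nsq_ge0 // subr_ge0 (le_trans (rs _ h)).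
rewrite (big_rem r0) //= ltr_wpDr //.
  by rewrite big_seq sumr_ge0 // => r /mem_rem; apply: e0.
rewrite divr_gt0 ?subr_gt0 ?(lt_le_trans r0rho) // mulr_gt0 // nsq_gt0 subr_eq0.
exact: ur.
Qed.

Lemma size_rot n rho eta f : balanced n rho f -> (0 < n)%N ->
  size (rot n eta f) = n.+1.
Proof.
case=> sf cf rf n0.
have cn : (rot n eta f)`_n != 0.
  rewrite coef_rot mulf_neq0 //.
    rewrite natC eq_complex negb_and; apply/orP; left => /=.
    have -> : n%:R - n%:R / 2 = n%:R / 2 :> R by field.
    by rewrite mulf_neq0 ?invr_eq0 ?pnatr_eq0 // -lt0n.
  by rewrite -[n]/(n.+1.-1) -sf -lead_coefE lead_coef_eq0 -size_poly_eq0 sf.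
apply/eqP; rewrite eqn_leq; apply/andP; split; last first.
  by rewrite ltnNge; apply: contra cn => /leq_sizeP /(_ n (leqnn _)) ->.
apply/leq_sizeP => j jn; rewrite coef_rot.
by move/leq_sizeP : (eq_leq sf) => -> //; rewrite mulr0.
Qed.


(** The extreme coefficients are multiplied by -n/2 - i eta and n/2 - i eta, which have the same
    modulus. *)
Lemma rot_balanced n rho eta f : balanced n rho f -> 1 < rho -> (0 < n)%N ->
  balanced n rho (rot n eta f).
Proof.
move=> bf rho1 n0; case: (bf) => sf cf rf; split.
- exact: size_rot bf n0.
- rewrite !coef_rot !nsqM cf; congr (_ * _).
  rewrite !natC /nsq /=; have -> : n%:R - n%:R / 2 = n%:R / 2 :> R by field.
  by rewrite sub0r sqrrN.
- move=> r rr; rewrite leNgt; apply: contraL rr => rhor.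
  apply: (rot_not_root _ bf) => //; first exact: ltW.
  by apply/negP => /rf; rewrite leNgt rhor.
Qed.

(** For a root of multiplicity m + 1, a factor (X - u)^m splits off and its cofactor takes at u the
    value (m + 1) u g(u), nonzero since |u| > 1. A non-root stays a non-root by [rot_not_root],
    which fits the predecessor of 0. *)
Lemma mup_rot n rho eta f u : balanced n rho f -> 1 < rho -> (0 < n)%N ->
  rho <= nsq u -> mup u (rot n eta f) = (mup u f).-1.
Proof.
move=> bf rho1 n0 ru; case: (bf) => sf cf rf.
have f0 : f != 0 by rewrite -size_poly_eq0 sf.
have [m [g gu fE]] := multiplicity_XsubC f u.
rewrite f0 /= in gu.
case: m fE => [|m] fE.
  have fu : ~~ root f u by rewrite fE expr0 mulr1.
  by rewrite !mupNroot // (rot_not_root _ bf).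
have -> : mup u f = m.+1.
  by rewrite fE mupMr // mup_XsubCX eqxx.
have -> : rot n eta f = ('X * (g^`() * ('X - u%:P) + g *+ m.+1)
    - (n%:R / 2 +i* eta) *: g * ('X - u%:P)) * ('X - u%:P) ^+ m.
  rewrite /rot {}fE derivM deriv_exp derivXsubC mul1r -pred_Sn.
  move: ('X - u%:P) => P; rewrite -[P ^+ m *+ _]mulr_natr -[g *+ _]mulr_natr.
  by rewrite -!mul_polyC exprS; ring.
rewrite mupMr ?mup_XsubCX ?eqxx //.
rewrite /root !hornerE subrr !(mulr0, mul0r) add0r subr0 hornerMn -mulr_natr.
rewrite !mulf_neq0 //; last by rewrite pnatr_eq0.
by rewrite -nsq_eq0 gt_eqF // (lt_le_trans _ ru) // (lt_trans _ rho1).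
Qed.

Lemma max_nsq (s : seq R[i]) : s != [::] ->
  exists2 u, u \in s & forall r, r \in s -> nsq r <= nsq u.
Proof.
elim: s => [//|a [|b s] IH] _.
  by exists a => [|r]; rewrite inE ?eqxx // => /eqP ->.
have [//|u us hu] := IH; case: (leP (nsq a) (nsq u)) => [au|/ltW ua].
  by exists u; [rewrite inE us orbT | move=> r; rewrite inE => /predU1P[->|/hu]].
exists a => [|r]; rewrite inE ?eqxx // => /predU1P[->|/hu] //.
by move/le_trans; apply.
Qed.

Lemma foldr_rot_balanced n rho f etas : balanced n rho f -> 1 < rho -> (0 < n)%N ->
  balanced n rho (foldr (rot n) f etas) /\
  forall u, rho <= nsq u -> mup u (foldr (rot n) f etas) = (mup u f - size etas)%N.
Proof.
move=> bf rho1 n0; elim: etas => [|e etas [IH1 IH2]] /=; first by split=> // u; rewrite subn0.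
split; first exact: rot_balanced IH1 _ _.
by move=> u ru; rewrite (mup_rot _ IH1) // IH2 // subnS.
Qed.

(** X d/dX is diagonal on monomials, so a recurrence with coefficients polynomial in j is the same
    as an identity between iterated [rot]. *)
Lemma coef_foldr_rot n f etas j :
  (foldr (rot n) f etas)`_j =
  (\prod_(e <- etas) (j%:R - (n%:R / 2 +i* e))) * f`_j.
Proof.
by elim: etas => [|e etas IH] /=; rewrite ?big_nil ?mul1r // big_cons coef_rot IH mulrA.
Qed.

(* The coefficient identity reads (1 - X) p = - B(theta - (n+1)/2) ((1 + X) p) with
   theta = X d/dX. If p had roots off the unit circle, B(theta - (n+1)/2) would strictly
   lower the multiplicity of an outermost root of (1 + X) p, while both sides have the
   same multiplicity there as p. *)
Lemma roots_unimodular n p (B : {poly R[i]}) :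
  size p = n.+1 -> nsq p`_0 = nsq p`_n -> B != 0 -> root B 0 ->
  (forall b, root B b -> complex.Re b = 0) ->
  (forall j, ((1 - 'X) * p)`_j = - (B.[j%:R - n.+1%:R / 2] * ((1 + 'X) * p)`_j)) ->
  forall r, root p r -> nsq r = 1.
Proof.
move=> sp cp B0 rB0 rB id.
have p0 : p != 0 by rewrite -size_poly_eq0 sp.
have [s pE] := closed_field_poly_normal p.
have lp0 : lead_coef p != 0 by rewrite lead_coef_eq0.
have rp r : root p r = (r \in s) by rewrite pE rootZ // root_prod_XsubC.
have le1 r : r \in s -> nsq r <= 1.
  move=> rs; rewrite leNgt; apply/negP => r1.
  (* The outermost root u fixes the radius [rho]; the added root -1 of (1 + X) p lies strictly
     inside. *)
  have [|u us hu] := @max_nsq s; first by case: (s) rs.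
  set rho := nsq u.
  have rho1 : 1 < rho by apply: lt_le_trans r1 (hu _ rs).
  set f := (1 + 'X) * p.
  have sX : size (1 + 'X : {poly R[i]}) = 2 by rewrite addrC -[1]polyC1 size_XaddC.
  have X0 : 1 + 'X != 0 :> {poly R[i]} by rewrite -size_poly_eq0 sX.
  have cf0 : f`_0 = p`_0 by rewrite /f mulrDl mul1r coefD coefXM /= addr0.
  have cfn : f`_n.+1 = p`_n.
    rewrite /f mulrDl mul1r coefD coefXM /=.
    by move/leq_sizeP : (eq_leq sp) => -> //; rewrite add0r.
  have bf : balanced n.+1 rho f.
    split; first by rewrite size_mul // sX sp.
      by rewrite cf0 cfn.
    move=> x; rewrite /f rootM => /orP[|].
      rewrite /root !hornerE addrC addr_eq0 => /eqP ->.
      by rewrite nsqN nsq1 ltW.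
    by rewrite rp; apply: hu.
  have [sB BE] := closed_field_poly_normal B.
  have lB0 : lead_coef B != 0 by rewrite lead_coef_eq0.
  have sBr b : root B b = (b \in sB) by rewrite BE rootZ // root_prod_XsubC.
  (* Every root of B is i times its imaginary part, hence accounts for exactly one [rot]. *)
  set g := foldr (rot n.+1) f [seq complex.Im b | b <- sB].
  have gE : lead_coef B *: g = - ((1 - 'X) * p).
    apply/polyP => j; rewrite coefZ coefN id opprK -/f coef_foldr_rot mulrA.
    congr (_ * _); rewrite {2}BE hornerZ horner_prod big_map; congr (_ * _).
    rewrite !big_seq; apply: eq_bigr => b; rewrite -sBr => /rB b0.
    rewrite hornerXsubC half_natC natC; case: (b) b0 => x y /= ->.
    by apply/eqP; rewrite eq_complex /= !subr0 sub0r !eqxx.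
  have [bg mg] := foldr_rot_balanced [seq complex.Im b | b <- sB] bf rho1 isT.
  have u1 (c : R[i]) : nsq c = 1 -> u != c.
    by move=> c1; apply: contraTneq rho1 => uc; rewrite /rho uc c1 ltxx.
  have Xu : ~~ root (1 + 'X) u.
    rewrite /root !hornerE addrC addr_eq0; apply: u1; by rewrite nsqN nsq1.
  have Xu' : ~~ root (1 - 'X) u.
    rewrite /root !hornerE subr_eq0 eq_sym; apply: u1; by rewrite nsq1.
  have mf : mup u f = mup u p by rewrite mupMr.
  have : mup u (lead_coef B *: g) = mup u p.
    rewrite gE -mulNr mupMr // rootN //.
  rewrite -mul_polyC mupMr ?rootC // /g mg // mf size_map.
  have : (0 < mup u p)%N by rewrite -XsubC_dvd // dvdp_XsubCl rp.
  (* The root 0 of B guarantees that at least one [rot] is applied, so the multiplicity at u really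
     drops. *)
  have : (0 < size sB)%N by move: rB0; rewrite sBr; case: (sB).
  by move=> a b /eqP; apply/negP; rewrite neq_ltn ltn_subrL a b.
(* All roots now lie in the closed disc and their moduli multiply to 1, so none lies strictly
   inside. *)
have bp : balanced n 1 p by split=> // r; rewrite rp => /le1.
have [t [tE _ tp _ tle]] := balanced_roots bp.
move=> r; rewrite {1}tE rootZ // root_prod_XsubC => rt.
apply/eqP; rewrite eq_le tle //= -tp (big_rem r) //= ler_piMr ?nsq_ge0 //.
rewrite big_seq prodr_ile1 // => x /mem_rem /tle ->.
by rewrite nsq_ge0.
Qed.

(** * Polynomials with purely imaginary zeros and their central differences *)

Definition qeval (k : R) (M : nat) (gs : seq R) z : R[i] :=
  k%:C * z ^+ M * \prod_(g <- gs) (1 + g%:C ^+ 2 * z ^+ 2).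

(** The factors are |1 + i g z|^2 and |1 - i g z|^2. For fixed Im z both are nondecreasing in (Re
    z)^2. *)
Lemma nsq_quadratic (g : R) z : nsq (1 + g%:C ^+ 2 * z ^+ 2) =
  ((1 - g * complex.Im z) ^+ 2 + g ^+ 2 * complex.Re z ^+ 2) *
  ((1 + g * complex.Im z) ^+ 2 + g ^+ 2 * complex.Re z ^+ 2).
Proof. by case: z => a b; rewrite /nsq !expr2 /=; ring. Qed.

(** Moving horizontally away from the imaginary axis increases the distance to every zero;
    strictness comes from the zero at the origin. *)
Lemma qeval_nsq_lt k M gs (z w : R[i]) : k != 0 -> (0 < M)%N ->
  complex.Im z = complex.Im w -> complex.Re z ^+ 2 < complex.Re w ^+ 2 ->
  nsq (qeval k M gs z) < nsq (qeval k M gs w).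
Proof.
move=> k0 M0 im re; rewrite /qeval.
have zw : nsq z < nsq w by rewrite /nsq im ltrD2r.
have nsqX x : nsq (x ^+ M) = nsq x ^+ M.
  by elim: (M) => [|m IH]; rewrite ?expr0 ?nsq1 // !exprS nsqM IH.
have kC0 : k%:C != 0 by rewrite (inj_eq (@complexI R) k 0).
elim: gs => [|g gs IH].
  by rewrite !big_nil !mulr1 !nsqM ltr_pM2l ?nsq_gt0 // !nsqX ltrXn2r -?lt0n ?nsq_ge0 // gtn_eqF.
rewrite !big_cons [in ltLHS]mulrCA [ltLHS]nsqM [in ltRHS]mulrCA [ltRHS]nsqM.
have [->|g0] := eqVneq g 0.
  by rewrite rmorph0 expr0n !mul0r !addr0 nsq1 !mul1r.
have g2 : 0 < g ^+ 2 by rewrite exprn_even_gt0.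
have wpos c : 0 < c ^+ 2 + g ^+ 2 * complex.Re w ^+ 2.
  by rewrite ltr_wpDl ?sqr_ge0 // mulr_gt0 // (le_lt_trans _ re) // sqr_ge0.
have le c : 0 <= c ^+ 2 + g ^+ 2 * complex.Re z ^+ 2 <= c ^+ 2 + g ^+ 2 * complex.Re w ^+ 2.
  apply/andP; split.
    by apply: addr_ge0; [|apply: mulr_ge0]; apply: sqr_ge0.
  by rewrite lerD2l; apply: ler_wpM2l; [rewrite sqr_ge0 | apply: ltW].
have fw : 0 < nsq (1 + g%:C ^+ 2 * w ^+ 2) by rewrite nsq_quadratic mulr_gt0.
apply: (@le_lt_trans _ _ (nsq (1 + g%:C ^+ 2 * w ^+ 2) * nsq (qeval k M gs z))).
  rewrite ler_wpM2r ?nsq_ge0 // !nsq_quadratic im.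
  have /andP[? ?] := le (1 - g * complex.Im w).
  have /andP[? ?] := le (1 + g * complex.Im w).
  exact: ler_pM.
by rewrite ltr_pM2l.
Qed.

Definition qpoly k M gs : {poly R[i]} :=
  k%:C *: 'X^M * \prod_(g <- gs) (1 + (g%:C ^+ 2) *: 'X^2).

Lemma horner_qpoly k M gs z : (qpoly k M gs).[z] = qeval k M gs z.
Proof.
rewrite /qpoly /qeval hornerM hornerZ hornerXn horner_prod; congr (_ * _).
by apply: eq_bigr => g _; rewrite !hornerE.
Qed.

(** Its value at j - 1/2 is the coefficient A_j of the recurrence. Centring the difference puts its
    roots on the imaginary axis and makes it odd when q is even. *)
Definition dpoly k M gs (h : R) : {poly R[i]} :=
  2^-1 *: ((qpoly k M gs \Po (h%:C *: ('X + 2^-1%:P)))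
           - (qpoly k M gs \Po (h%:C *: ('X - 2^-1%:P)))).

Lemma horner_dpoly k M gs h z : (dpoly k M gs h).[z] =
  (qeval k M gs (h%:C * (z + 2^-1)) - qeval k M gs (h%:C * (z - 2^-1))) / 2.
Proof.
by rewrite /dpoly !hornerE !horner_comp !horner_qpoly !hornerE mulrC.
Qed.

(** At a root the values of q at h (z + 1/2) and h (z - 1/2) agree. These points share their
    imaginary part, so by [qeval_nsq_lt] the squares of their real parts must agree. *)
Lemma root_dpoly k M gs h z : k != 0 -> (0 < M)%N -> 0 < h ->
  root (dpoly k M gs h) z -> complex.Re z = 0.
Proof.
move=> k0 M0 h0; rewrite /root horner_dpoly mulf_eq0 orbC invr_eq0 pnatr_eq0 /=.
rewrite subr_eq0 => /eqP/(congr1 nsq) e.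
have half : 2^-1 = 2^-1%:C :> R[i] by rewrite fmorphV rmorph_nat.
have reE (s : R) : complex.Re (h%:C * (z + s%:C)) = h * (complex.Re z + s).
  by case: (z) => a b /=; ring.
have imE (s : R) : complex.Im (h%:C * (z + s%:C)) = h * complex.Im z.
  by case: (z) => a b /=; ring.
have halfN : - 2^-1 = (- 2^-1)%:C :> R[i] by rewrite half rmorphN.
have lt1 (s t : R) : (complex.Re z + s) ^+ 2 < (complex.Re z + t) ^+ 2 ->
    nsq (qeval k M gs (h%:C * (z + s%:C))) < nsq (qeval k M gs (h%:C * (z + t%:C))).
  move=> st; apply: qeval_nsq_lt => //; first by rewrite !imE.
  by rewrite !reE !exprMn ltr_pM2l // exprn_gt0.
have [z0|z0|//] := ltrgt0P (complex.Re z).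
- have := lt1 (- 2^-1) (2^-1); rewrite -halfN -half e ltxx => h1; have // : false.
  apply: h1; rewrite -subr_gt0.
  have -> : (complex.Re z + 2^-1) ^+ 2 - (complex.Re z - 2^-1) ^+ 2 = 2 * complex.Re z.
    by field.
  by rewrite mulr_gt0.
- have := lt1 (2^-1) (- 2^-1); rewrite -halfN -half e ltxx => h1; have // : false.
  apply: h1; rewrite -subr_gt0.
  have -> : (complex.Re z - 2^-1) ^+ 2 - (complex.Re z + 2^-1) ^+ 2 = 2 * - complex.Re z.
    by field.
  by rewrite mulr_gt0 // oppr_gt0.
Qed.

Definition qreal (k : R) (M : nat) (gs : seq R) (x : R) : R :=
  k * x ^+ M * \prod_(g <- gs) (1 + g ^+ 2 * x ^+ 2).

Lemma qeval_real k M gs x : qeval k M gs x%:C = (qreal k M gs x)%:C.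
Proof.
rewrite /qeval /qreal !rmorphM rmorphXn rmorph_prod; congr (_ * _).
by apply: eq_bigr => g _; rewrite rmorphD rmorphM !rmorphXn rmorph1.
Qed.

(** * Symmetric Laurent sums and their factorisation *)

Definition laurent (N : nat) (w : nat -> R) u : R[i] :=
  (w 0)%:C + \sum_(1 <= j < N.+1) (w j)%:C * (u ^+ j + u ^- j).

(** With truncated subtraction, [i - N + (N - i)] is |i - N|. *)
Definition symm_poly (N : nat) (w : nat -> R) : {poly R[i]} :=
  \poly_(i < N.*2.+1) (w (i - N + (N - i))%N)%:C.

Lemma horner_symm_poly N w u : u != 0 ->
  (symm_poly N w).[u] = u ^+ N * laurent N w u.
Proof.
move=> u0; rewrite /symm_poly horner_poly /laurent.
elim: N => [|N IH].
  by rewrite big_ord_recl big_ord0 /= expr0 mulr1 mul1r big_geq // addr0.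
rewrite doubleS big_ord_recl big_ord_recr /= !(sub0n, subn0, add0n) expr0 mulr1 big_nat_recr //=.
under eq_bigr => i _ do rewrite /bump /= add1n !subSS exprS mulrCA.
rewrite -mulr_sumr IH.
have -> : (N.*2.+2 - N.+1 + (N.+1 - N.*2.+2) = N.+1)%N.
  by rewrite -addnn; lia.
rewrite -addnn; set S := \sum_(1 <= j < N.+1) _.
have -> : u ^+ (N + N).+2 = u ^+ N.+1 * u ^+ N.+1 by rewrite -exprD addSn addnS.
rewrite exprS; field.
by rewrite u0 expf_neq0.
Qed.

Lemma laurentV N w u : laurent N w u^-1 = laurent N w u.
Proof.
by rewrite /laurent; congr (_ + _); apply: eq_bigr => j _; rewrite -exprVn invrK addrC exprVn.
Qed.

Lemma symm_poly_unimodular k M gs h N w :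
  0 < k -> (0 < M)%N -> ~~ odd M -> 0 < h ->
  (forall j, 0 < w j \/ (N < j)%N) -> w N.+1 = 0 ->
  (forall j, (j <= N)%N ->
     w j - w j.+1 = (qreal k M gs (h * j.+1%:R) - qreal k M gs (h * j%:R)) / 2 *
                    (w j + w j.+1)) ->
  forall r, root (symm_poly N w) r -> nsq r = 1.
Proof.
move=> k0 M0 Mev h0 wpos wN rec.
have wpos' j : (j <= N)%N -> 0 < w j.
  by case: (wpos j) => // Nj jN; move: (leq_trans Nj jN); rewrite ltnn.
set p := symm_poly N w.
(* The formula remains valid one index beyond the degree, because [w N.+1 = 0]; the index -1 is
   treated alike in [prevE]. *)
have coefp i : (i <= N.*2.+1)%N -> p`_i = (w (i - N + (N - i))%N)%:C.
  move=> iN; rewrite coef_poly; case: ltnP => // iN'.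
  have -> : i = N.*2.+1 by apply/eqP; rewrite eqn_leq iN iN'.
  have -> : (N.*2.+1 - N + (N - N.*2.+1) = N.+1)%N by rewrite -addnn; lia.
  by rewrite wN.
have qeven x : qreal k M gs (- x) = qreal k M gs x.
  rewrite /qreal exprNn -signr_odd (negbTE Mev) expr0 mul1r; congr (_ * _).
  by apply: eq_bigr => g _; rewrite sqrrN.
have sp : size p = N.*2.+1.
  rewrite size_poly_eq //.
  have -> : (N.*2 - N + (N - N.*2) = N)%N by rewrite -addnn; lia.
  by rewrite (inj_eq (@complexI R) _ 0) gt_eqF // wpos'.
have id j : ((1 - 'X) * p)`_j =
    - ((dpoly k M gs h).[j%:R - N.*2.+1%:R / 2] * ((1 + 'X) * p)`_j).
  have -> : ((1 - 'X) * p)`_j = p`_j - (if j == 0%N then 0 else p`_j.-1).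
    by rewrite mulrBl mul1r coefB coefXM.
  have -> : ((1 + 'X) * p)`_j = p`_j + (if j == 0%N then 0 else p`_j.-1).
    by rewrite mulrDl mul1r coefD coefXM.
  case: (leqP j N.*2.+1) => jN; last first.
    have z i : (N.*2.+1 <= i)%N -> p`_i = 0.
      by move=> Ni; apply/leq_sizeP : Ni; rewrite sp.
    rewrite z ?(ltnW jN) // z; last by case: (j) jN.
    by rewrite if_same addr0 subr0 mulr0 oppr0.
  have prevE : (if j == 0%N then 0 else p`_j.-1) = (w (j - N.+1 + (N.+1 - j))%N)%:C.
    case: j jN => [|j] jN /=; first by rewrite !(sub0n, subn0, add0n) wN.
    by rewrite coefp ?(ltnW jN) // !subSS.
  rewrite prevE coefp // horner_dpoly.
  have -> : h%:C * (j%:R - N.*2.+1%:R / 2 + 2^-1) = (h * (j%:R - N%:R))%:C.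
    rewrite rmorphM rmorphB !rmorph_nat; congr (_ * _).
    by rewrite -addnn -[(N + N).+1]addn1 !natrD; field.
  have -> : h%:C * (j%:R - N.*2.+1%:R / 2 - 2^-1) = (h * (j%:R - N.+1%:R))%:C.
    rewrite rmorphM rmorphB !rmorph_nat; congr (_ * _).
    by rewrite -addnn -[(N + N).+1]addn1 -[N.+1]addn1 !natrD; field.
  have half : 2^-1 = 2^-1%:C :> R[i] by rewrite fmorphV rmorph_nat.
  rewrite !qeval_real half -!(rmorphB, rmorphD, rmorphM, rmorphN); congr (_%:C).
  (* On the left half the weights increase with j, so the recurrence is read backwards and evenness
     of q supplies the sign; on the right half it applies as it stands. *)
  case: (leqP j N) => jN'.
    have -> : (j - N + (N - j) = N - j)%N by lia.
    have -> : (j - N.+1 + (N.+1 - j) = (N - j).+1)%N by lia.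
    rewrite rec ?leq_subr //.
    rewrite -[j%:R - N%:R]opprB -[j%:R - N.+1%:R]opprB !mulrN !qeven.
    rewrite -!natrB // ?(leqW jN') // subSn //; ring.
  have -> : (j - N + (N - j) = (j - N.+1).+1)%N by lia.
  have -> : (j - N.+1 + (N.+1 - j) = j - N.+1)%N by lia.
  rewrite -opprB rec; last by rewrite -addnn in jN; lia.
  rewrite -!natrB // ?(ltnW jN') // -subSn //; ring.
apply: (@roots_unimodular N.*2 p (dpoly k M gs h)) => //.
- rewrite !coefp // ?leqnSn // sub0n subn0 add0n.
  by have -> : (N.*2 - N + (N - N.*2) = N)%N by rewrite -addnn; lia.
(* At the top index the left side of the identity is - w_N, which is nonzero. *)
- apply/eqP => d0; have := id N.*2.+1.
  rewrite d0 horner0 mul0r oppr0 mulrBl mul1r coefB coefXM /= !coefp ?leqnn // ?leqnSn //.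
  have -> : (N.*2.+1 - N + (N - N.*2.+1) = N.+1)%N by rewrite -addnn; lia.
  have -> : (N.*2 - N + (N - N.*2) = N)%N by rewrite -addnn; lia.
  rewrite wN sub0r => /eqP; rewrite oppr_eq0 (inj_eq (@complexI R) _ 0).
  by rewrite gt_eqF // wpos'.
- have half : 2^-1 = 2^-1%:C :> R[i] by rewrite fmorphV rmorph_nat.
  rewrite /root horner_dpoly add0r sub0r half -rmorphN -!rmorphM !qeval_real.
  by rewrite mulrN qeven subrr mul0r.
- by move=> b; apply: root_dpoly; rewrite ?gt_eqF.
Qed.

(** The square L(u)^2 equals p(u) p(1/u), so each root r yields (u - r)(1/u - r) = (1 - r)^2 + r (2
    - u - 1/u) without pairing r with its conjugate. For |r| = 1 the quotient r / (1 - r)^2 is - 1 /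
    |1 - r|^2, which gives s = 1 / |1 - r|^2. *)
Lemma laurent_factor k M gs h N w :
  0 < k -> (0 < M)%N -> ~~ odd M -> 0 < h ->
  (forall j, 0 < w j \/ (N < j)%N) -> w N.+1 = 0 ->
  (forall j, (j <= N)%N ->
     w j - w j.+1 = (qreal k M gs (h * j.+1%:R) - qreal k M gs (h * j%:R)) / 2 *
                    (w j + w j.+1)) ->
  exists2 ss : seq R, all (fun s => 0 <= s) ss & forall u, u != 0 ->
    laurent N w u ^+ 2 =
    laurent N w 1 ^+ 2 * \prod_(s <- ss) (1 - s%:C * (2 - u - u^-1)).
Proof.
move=> k0 M0 Mev h0 wpos wN rec.
have rt := symm_poly_unimodular k0 M0 Mev h0 wpos wN rec.
have [rs pE] := closed_field_poly_normal (symm_poly N w).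
set c := lead_coef _ in pE.
have w0 : 0 < w 0%N by case: (wpos 0%N).
(* A sum of nonnegative terms with w_0 > 0; hence 1 is not a root and s is finite. *)
have L1 : laurent N w 1 != 0.
  rewrite /laurent.
  have -> : \sum_(1 <= j < N.+1) (w j)%:C * (1 ^+ j + 1 ^- j) =
      (\sum_(1 <= j < N.+1) w j * 2)%:C :> R[i].
    rewrite rmorph_sum; apply: eq_bigr => j _.
    by rewrite rmorphM rmorph_nat expr1n invr1.
  rewrite -rmorphD (inj_eq (@complexI R) _ 0) gt_eqF // ltr_wpDr //.
  rewrite big_nat sumr_ge0 // => j /andP[_ jN].
  by rewrite mulr_ge0 //; case: (wpos j) => [/ltW //|]; rewrite ltnNge -ltnS jN.
have hE u : u != 0 -> laurent N w u ^+ 2 = c ^+ 2 * \prod_(r <- rs) ((u - r) * (u^-1 - r)).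
  move=> u0; have u0' : u^-1 != 0 by rewrite invr_eq0.
  have -> : laurent N w u ^+ 2 = (symm_poly N w).[u] * (symm_poly N w).[u^-1].
    rewrite !horner_symm_poly // laurentV exprVn; field.
    by rewrite expf_neq0.
  rewrite pE !hornerZ !horner_prod big_split /=.
  under eq_bigr do rewrite hornerXsubC.
  under [X in _ * (_ * X)]eq_bigr do rewrite hornerXsubC.
  ring.
have rs1 r : r \in rs -> nsq r = 1 /\ nsq (1 - r) != 0.
  move=> rrs; have rr : root (symm_poly N w) r.
    rewrite pE rootE hornerZ mulf_eq0; apply/orP; right.
    by rewrite -/(root _ r) root_prod_XsubC.
  split; first exact: rt.
  rewrite nsq_eq0 subr_eq0; apply: contraTneq rr => <-.
  by rewrite /root horner_symm_poly ?oner_neq0 // expr1n mul1r.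
exists [seq (nsq (1 - r))^-1 | r <- rs].
  by apply/allP => s /mapP[r _ ->]; rewrite invr_ge0 nsq_ge0.
move=> u u0; rewrite !hE ?oner_neq0 // invr1 big_map -[RHS]mulrA -big_split /=; congr (_ * _).
rewrite !big_seq; apply: eq_bigr => r /rs1[r1 r2].
(* On the unit circle |1 - r|^2 = (1 - r)(1 - 1/r). *)
have key : r * (nsq (1 - r))%:C = - (1 - r) ^+ 2.
  case: (r) r1 => a b; rewrite /nsq /= => r1.
  have b2 : b ^+ 2 = 1 - a ^+ 2 by rewrite -r1 addrC addKr.
  by apply/eqP; rewrite expr2 eq_complex /=; apply/andP; split; apply/eqP; ring: b2.
have n0 : (nsq (1 - r))%:C != 0 by rewrite (inj_eq (@complexI R) _ 0).
have q : (1 - r) * (1 - r) * ((nsq (1 - r))^-1)%:C = - r.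
  by rewrite fmorphV -expr2 -[_ ^+ 2]opprK -key mulNr mulfK.
rewrite [RHS]mulrBr mulr1 (mulrA ((1 - r) * (1 - r))) q; field.
by rewrite u0.
Qed.

End UnitCircle.
End Alg.

(** * Real and imaginary parts of symmetric exponential sums *)

Fixpoint psum (f : nat -> R) (n : nat) : R :=
  match n with O => 0 | S n' => psum f n' + f (S n') end.

Definition qpol (k : R) (m : nat) (gs : list R) (x : R) : R :=
  k * x ^ (2 * m) * fold_right (fun g acc => (1 + g ^ 2 * x ^ 2) * acc) 1 gs.

(* [cos_sum_re + i cos_sum_im = sum_{|j| <= N} w_|j| e^(i j (a + i b))]. *)
Definition cos_sum_re (N : nat) (w : nat -> R) (a b : R) : R :=
  w 0%nat + psum (fun j => w j * (2 * (cosh (INR j * b) * cos (INR j * a)))) N.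

Definition cos_sum_im (N : nat) (w : nat -> R) (a b : R) : R :=
  - psum (fun j => w j * (2 * (sinh (INR j * b) * sin (INR j * a)))) N.

(** [expi_re] and [expi_im] are the two parts of e^(i (a + i b)). *)
Definition expi_re (a b : R) : R := exp (- b) * cos a.
Definition expi_im (a b : R) : R := exp (- b) * sin a.

Lemma expi_re_plus a b a' b' : expi_re (a + a') (b + b') =
  expi_re a b * expi_re a' b' - expi_im a b * expi_im a' b'.
Proof.
unfold expi_re, expi_im; rewrite Ropp_plus_distr, exp_plus, cos_plus; ring.
Qed.

Lemma expi_im_plus a b a' b' : expi_im (a + a') (b + b') =
  expi_re a b * expi_im a' b' + expi_im a b * expi_re a' b'.
Proof.
unfold expi_re, expi_im; rewrite Ropp_plus_distr, exp_plus, sin_plus; ring.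
Qed.

Lemma expi_re_sym a b : expi_re a b + expi_re (- a) (- b) = 2 * (cosh b * cos a).
Proof. unfold expi_re, cosh; rewrite cos_neg, Ropp_involutive; field. Qed.

Lemma expi_im_sym a b : expi_im a b + expi_im (- a) (- b) = - (2 * (sinh b * sin a)).
Proof. unfold expi_im, sinh; rewrite sin_neg, Ropp_involutive; field. Qed.

(* [|1 - s (2 - 2 cos (a + i b))|^2]. *)
Definition factor_sqr (a b s : R) : R :=
  (1 - s * (2 - 2 * (cosh b * cos a))) ^ 2 + (s * (2 * (sinh b * sin a))) ^ 2.

Lemma INR_S_mul j a : INR (S j) * a = a + INR j * a.
Proof. rewrite S_INR; ring. Qed.

Lemma expi_0 : expi_re 0 0 = 1 /\ expi_im 0 0 = 0.
Proof. unfold expi_re, expi_im; rewrite Ropp_0, exp_0, cos_0, sin_0; split; ring. Qed.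

(** The left side has the shape to which |1 - s V|^2 unfolds when the real s is embedded as s + 0 i,
    so that [nsq_factor] closes by conversion. *)
Lemma factor_sqr_eq a b s V1 V2 :
  V1 = 2 - (expi_re a b + expi_re (- a) (- b)) ->
  V2 = 0 - (expi_im a b + expi_im (- a) (- b)) ->
  (1 - (s * V1 - 0 * V2)) ^ 2 + (0 - (s * V2 + 0 * V1)) ^ 2 = factor_sqr a b s.
Proof.
intros -> ->; rewrite expi_re_sym, expi_im_sym; unfold factor_sqr; ring.
Qed.

(** * Transfer of the factorisation to the Stdlib reals *)

Module Bridge.
Import Alg all_boot all_order all_algebra complex Rstruct.
Import Order.TTheory GRing.Theory Num.Theory.
Local Open Scope ring_scope.
Local Open Scope complex_scope.

Definition expi (a b : R) : R[i] := expi_re a b +i* expi_im a b.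

Lemma complex_ext (x y x' y' : R) : x = x' -> y = y' -> x +i* y = x' +i* y'.
Proof. by move=> -> ->. Qed.

Lemma expiD a b a' b' : expi (Rplus a a') (Rplus b b') = expi a b * expi a' b'.
Proof. exact: complex_ext (expi_re_plus _ _ _ _) (expi_im_plus _ _ _ _). Qed.

Lemma expi00 : expi R0 R0 = 1.
Proof. exact: complex_ext (proj1 expi_0) (proj2 expi_0). Qed.

Lemma expiV a b : (expi a b)^-1 = expi (Ropp a) (Ropp b).
Proof.
have h : expi a b * expi (Ropp a) (Ropp b) = 1 by rewrite -expiD !Rplus_opp_r expi00.
have e0 : expi a b != 0 by apply/eqP => e; move: h; rewrite e mul0r => /eqP; rewrite eq_sym oner_eq0.
by apply: (mulfI e0); rewrite h mulfV.
Qed.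

Lemma expi_neq0 a b : expi a b != 0.
Proof.
apply/eqP => e; have := expiD a b (Ropp a) (Ropp b).
by rewrite e mul0r !Rplus_opp_r expi00 => /eqP; rewrite oner_eq0.
Qed.

Lemma expiX a b j : expi a b ^+ j = expi (Rmult (INR j) a) (Rmult (INR j) b).
Proof.
elim: j => [|j IH]; first by rewrite expr0 !Rmult_0_l expi00.
by rewrite exprS IH -expiD !INR_S_mul.
Qed.

Lemma expi_sym a b : expi a b + expi (Ropp a) (Ropp b) =
  Rmult 2 (Rmult (cosh b) (cos a)) +i* Ropp (Rmult 2 (Rmult (sinh b) (sin a))).
Proof. exact: complex_ext (expi_re_sym a b) (expi_im_sym a b). Qed.

Lemma laurent_expi N w a b :
  laurent N w (expi a b) = cos_sum_re N w a b +i* cos_sum_im N w a b.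
Proof.
rewrite /laurent /cos_sum_re /cos_sum_im; elim: N => [|N IH].
  rewrite big_geq // addr0; apply: complex_ext => /=.
    by rewrite Rplus_0_r.
  by rewrite Ropp_0.
rewrite big_nat_recr //= addrA IH expiX expiV expi_sym; apply: complex_ext.
  set A := psum _ _; set t := Rmult 2 _; set t' := Ropp _.
  have : Rplus (w 0%N) (Rplus A (Rmult (w N.+1) t)) =
    Rplus (Rplus (w 0%N) A) (Rminus (Rmult (w N.+1) t) (Rmult 0 t')) by ring.
  by move=> ->.
set A := psum _ _; set t := Rmult 2 _; set t' := Rmult 2 _.
have : Ropp (Rplus A (Rmult (w N.+1) t)) =
  Rplus (Ropp A) (Rplus (Rmult (w N.+1) (Ropp t)) (Rmult 0 t')) by ring.
by move=> ->.
Qed.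

Lemma qreal_qpol k m gs x : qreal k (2 * m) gs x = qpol k m gs x.
Proof.
have e : fold_right (fun g acc => Rmult (Rplus 1 (Rmult (pow g 2) (pow x 2))) acc) R1 gs
    = \prod_(g <- gs) (1 + g ^+ 2 * x ^+ 2).
  by elim: gs => [|g gs IH]; rewrite ?big_nil // big_cons -IH /= -!RpowE.
by rewrite /qreal /qpol e RpowE -multE.
Qed.


Lemma nsq_factor a b s :
  nsq (1 - s%:C * (2 - expi a b - (expi a b)^-1)) = factor_sqr a b s.
Proof.
have two : 2 = IZR 2 +i* 0 :> R[i].
  by apply/eqP; rewrite eq_complex /= addr0 !eqxx.
rewrite expiV -addrA -opprD two /nsq -!RpowE.
exact: (@factor_sqr_eq a b s _ _ erefl erefl).
Qed.

(** Squared moduli are taken in the factorisation of L^2, so both sides are fourth powers of |L|, up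
    to the product; the reference point u = 1 is a = b = 0. *)
Lemma cos_sum_factor (k : R) (m : nat) (gs : list R) (h : R) (N : nat) (w : nat -> R) :
  Rlt 0 k -> Peano.le 1 m -> Rlt 0 h -> (forall j, Peano.le j N -> Rlt 0 (w j)) -> w (S N) = R0 ->
  (forall j, Peano.le j N -> Rminus (w j) (w (S j)) =
    Rmult (Rdiv (Rminus (qpol k m gs (Rmult h (INR (S j)))) (qpol k m gs (Rmult h (INR j)))) 2)
      (Rplus (w j) (w (S j)))) ->
  exists ss : list R, List.Forall (fun s => Rle 0 s) ss /\ forall a b,
    pow (Rplus (pow (cos_sum_re N w a b) 2) (pow (cos_sum_im N w a b) 2)) 2 =
    Rmult (pow (Rplus (pow (cos_sum_re N w 0 0) 2) (pow (cos_sum_im N w 0 0) 2)) 2)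
      (fold_right (fun s acc => Rmult (factor_sqr a b s) acc) (IZR 1) ss).
Proof.
move=> k0 m1 h0 wpos wN rec.
have k0' : 0 < k by apply/RltP.
have h0' : 0 < h by apply/RltP.
have M0 : (0 < 2 * m)%N by rewrite mul2n double_gt0; apply/ssrnat.leP.
have Mev : ~~ odd (2 * m) by rewrite mul2n odd_double.
have wpos' j : 0 < w j \/ (N < j)%N.
  by case: (leqP j N) => jN; [left; apply/RltP; apply: wpos; apply/ssrnat.leP | right].
have rec' j : (j <= N)%N -> w j - w j.+1 =
    (qreal k (2 * m) gs (h * j.+1%:R) - qreal k (2 * m) gs (h * j%:R)) / 2 * (w j + w j.+1).
  by move=> /ssrnat.leP/rec; rewrite !qreal_qpol !INRE.
have [ss ss0 ssE] := laurent_factor k0' M0 Mev h0' wpos' wN rec'.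
exists ss; split.
  by elim: (ss) ss0 => [|s t IH] /=; constructor; case/andP: ss0 => [/RleP s0 t0] //; apply: IH.
move=> a b; have := congr1 (@nsq _) (ssE _ (expi_neq0 a b)).
rewrite laurent_expi !expr2 !nsqM nsq_prod.
have -> : laurent N w 1 = laurent N w (expi R0 R0) by rewrite expi00.
rewrite laurent_expi.
have -> : \prod_(r <- ss) nsq (1 - r%:C * (2 - expi a b - (expi a b)^-1)) =
    fold_right (fun s acc => Rmult (factor_sqr a b s) acc) (IZR 1) ss.
  by elim: (ss) => [|s t IH]; rewrite ?big_nil // big_cons IH nsq_factor.
by rewrite /nsq !RpowE /= => e; rewrite !expr2 in e *.
Qed.

End Bridge.

(** * Lower bound off the real axis *)

Lemma exp_sub_exp_neg x : 0 <= x -> x <= exp x - exp (- x).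
Proof.
intros x0.
assert (h1 := exp_ineq1_le x).
assert (h2 := exp_ineq1_le x); rewrite exp_Ropp.
assert (h : / exp x <= / (1 + x)) by (apply Rinv_le_contravar; lra).
assert (/ (1 + x) <= 1) by (rewrite <- Rinv_1; apply Rinv_le_contravar; lra).
lra.
Qed.

Lemma cosh_sub_1 b : cosh b - 1 = (exp (b / 2) - exp (- (b / 2))) ^ 2 / 2.
Proof.
unfold cosh.
assert (e1 : exp b = exp (b / 2) * exp (b / 2)) by (rewrite <- exp_plus; f_equal; field).
assert (e2 : exp (- b) = exp (- (b / 2)) * exp (- (b / 2)))
  by (rewrite <- exp_plus; f_equal; field).
assert (e3 : exp (b / 2) * exp (- (b / 2)) = 1)
  by (rewrite <- exp_plus, Rplus_opp_r, exp_0; reflexivity).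
rewrite e1, e2; nra.
Qed.

Lemma cosh_neg b : cosh (- b) = cosh b.
Proof. unfold cosh; rewrite Ropp_involutive; field. Qed.

Lemma cosh_abs b : cosh (Rabs b) = cosh b.
Proof. unfold Rabs; destruct (Rcase_abs b); [apply cosh_neg|reflexivity]. Qed.

Lemma cosh_lower b : b ^ 2 / 8 <= cosh b - 1.
Proof.
rewrite <- cosh_abs, <- Rsqr_pow2, Rsqr_abs, Rsqr_pow2.
assert (b0 := Rabs_pos b); set (c := Rabs b) in *.
rewrite cosh_sub_1.
assert (h := exp_sub_exp_neg (c / 2)); nra.
Qed.

(** With x = |b| / 2 <= 1/2, exp x <= 1 / (1 - x) <= 1 + 2 x gives exp x - exp (- x) <= 3 x, and (3
    x)^2 / 2 = 9/8 b^2. *)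
Lemma cosh_upper b : Rabs b <= 1 -> cosh b - 1 <= 9 / 8 * b ^ 2.
Proof.
rewrite <- (cosh_abs b), <- (Rsqr_pow2 b), Rsqr_abs, Rsqr_pow2.
assert (b0 := Rabs_pos b); set (c := Rabs b) in *; intros c1.
rewrite cosh_sub_1; set (x := c / 2); assert (hx : 0 <= x <= / 2) by (unfold x; lra).
assert (h1 := exp_ineq1_le (- x)).
assert (h2 : exp x <= 1 + 2 * x).
{ rewrite <- (Ropp_involutive x), exp_Ropp.
  apply Rle_trans with (/ (1 + - x)); [apply Rinv_le_contravar; lra|].
  apply Rmult_le_reg_l with (1 + - x); [lra|].
  rewrite Rinv_r by lra; nra. }
assert (h3 : 0 <= exp x - exp (- x) <= 3 * x)
  by (assert (h4 := exp_sub_exp_neg x); lra).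
assert (c = 2 * x) by (unfold x; field); nra.
Qed.

Lemma cos_lower a : 1 - cos a <= a ^ 2 / 2.
Proof.
assert (e : cos a = 1 - 2 * sin (a / 2) * sin (a / 2))
  by (rewrite <- cos_2a_sin; f_equal; field).
assert (h : Rabs (sin (a / 2)) <= Rabs (a / 2)).
{ assert (h0 : forall t, 0 <= t -> Rabs (sin t) <= t).
  { intros t t0; destruct (Rle_dec t 1) as [t1|t1].
    - rewrite Rabs_pos_eq.
      + destruct (Req_dec t 0) as [->|]; [rewrite sin_0; lra|].
        apply Rlt_le, sin_lt_x; lra.
      + apply sin_ge_0; [lra|]; assert (h := PI2_1); lra.
    - assert (h := SIN_bound t); apply Rabs_le; lra. }
  unfold Rabs at 2; destruct (Rcase_abs (a / 2)); [|apply h0; lra].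
  rewrite <- (Rabs_Ropp (sin _)), <- sin_neg; apply h0; lra. }
apply Rsqr_le_abs_1 in h; unfold Rsqr in h; rewrite e; nra.
Qed.

Lemma cos_upper a : 1 - cos a >= 0.
Proof. assert (h := COS_bound a); lra. Qed.

(* |1 - cos (a + ib)| = cosh b - cos a. *)
Lemma factor_sqr_expand a b s :
  factor_sqr a b s =
  1 - 2 * (s * (2 - 2 * (cosh b * cos a))) + (s * (2 * (cosh b - cos a))) ^ 2.
Proof.
unfold factor_sqr.
assert (h1 : sinh b ^ 2 = cosh b ^ 2 - 1).
{ unfold sinh, cosh.
  assert (e : exp b * exp (- b) = 1) by (rewrite <- exp_plus, Rplus_opp_r, exp_0; reflexivity).
  nra. }
assert (h2 : sin a ^ 2 = 1 - cos a ^ 2) by (assert (h := sin2_cos2 a); unfold Rsqr in h; nra).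
replace ((s * (2 * (sinh b * sin a))) ^ 2) with (4 * s ^ 2 * (sinh b ^ 2 * sin a ^ 2)) by ring.
rewrite h1, h2; ring.
Qed.

(* (1 - 2u + t^2)(1 + Kt) - 1 >= t (K (t - g)^2 + K (1 - g^2) - 2g + t) when u <= g t. *)
Lemma quadratic_lower u t g K : 0 <= t -> 0 <= g <= 1 -> u <= g * t -> 0 <= K ->
  2 <= K * (1 - g ^ 2) -> exp (- (K * t)) <= 1 - 2 * u + t ^ 2.
Proof.
intros t0 g01 ug K0 Kg.
rewrite exp_Ropp.
assert (h : 1 + K * t <= exp (K * t)) by apply exp_ineq1_le.
assert (Kt : 0 <= K * t) by (apply Rmult_le_pos; lra).
apply Rle_trans with (/ (1 + K * t)); [apply Rinv_le_contravar; lra|].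
apply Rmult_le_reg_l with (1 + K * t); [lra|]; rewrite Rinv_r by lra.
assert (0 <= t * (K * (t - g) ^ 2 + K * (1 - g ^ 2) - 2 * g + t)).
{ apply Rmult_le_pos; [lra|]; assert (0 <= K * (t - g) ^ 2) by (apply Rmult_le_pos; [lra|apply pow2_ge_0]); lra. }
assert (0 <= (1 + K * t) * (g * t - u)) by (apply Rmult_le_pos; lra).
nra.
Qed.

Definition lsum (ss : list R) : R := fold_right Rplus 0 ss.

Lemma lsum_ge_0 ss : List.Forall (fun s => 0 <= s) ss -> 0 <= lsum ss.
Proof. induction 1; unfold lsum in *; simpl; lra. Qed.

Lemma prod_ge_exp (f : R -> R) c ss : (forall s, 0 <= s -> exp (- (c * s)) <= f s) ->
  List.Forall (fun s => 0 <= s) ss ->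
  exp (- (c * lsum ss)) <= fold_right (fun s acc => f s * acc) 1 ss.
Proof.
intros hf hs; induction hs as [|s ss s0 hs IH]; simpl.
- rewrite Rmult_0_r, Ropp_0, exp_0; lra.
- replace (- (c * (s + lsum ss))) with (- (c * s) + - (c * lsum ss)) by ring.
  rewrite exp_plus; apply Rmult_le_compat; auto; apply Rlt_le, exp_pos.
Qed.

(** Here v = |2 - 2 cos (h z)|. The real part of 2 - 2 cos (h z) is at most (1 - eta) v, with eta
    depending only on x / y and not on h. So [quadratic_lower] applies at t = s v, and v = O(h^2)
    gives the exponent. *)
Lemma factor_sqr_lower x y h s : y <> 0 -> 0 < h -> h * Rabs x <= 1 -> h * Rabs y <= 1 ->
  0 <= s ->
  exp (- (2 * (1 + 4 * x ^ 2 / y ^ 2) * (9 / 4 * y ^ 2 + x ^ 2) * h ^ 2 * s))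
    <= factor_sqr (h * x) (h * y) s.
Proof.
intros y0 h0 hx hy s0.
assert (y2 : 0 < y ^ 2) by (assert (0 < y * y) by (apply Rlt_0_sqr in y0; exact y0); nra).
set (r := x ^ 2 / y ^ 2); assert (r0 : 0 <= r)
  by (unfold r; apply Rmult_le_pos; [nra|apply Rlt_le, Rinv_0_lt_compat; lra]).
assert (rE : x ^ 2 = r * y ^ 2) by (unfold r; field; lra).
replace (4 * x ^ 2 / y ^ 2) with (4 * r) by (unfold r; field; lra).
rewrite rE.
set (a := h * x) in *; set (b := h * y) in *.
assert (ha : Rabs a <= 1) by (unfold a; rewrite Rabs_mult, (Rabs_pos_eq h); lra).
assert (hb : Rabs b <= 1) by (unfold b; rewrite Rabs_mult, (Rabs_pos_eq h); lra).
assert (ab : a ^ 2 = r * b ^ 2) by (unfold a, b; replace ((h * x) ^ 2) with (h ^ 2 * x ^ 2) by ring; rewrite rE; ring).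
assert (cl := cosh_lower b); assert (cu := cosh_upper b hb).
assert (al := cos_lower a); assert (au := cos_upper a).
assert (ca : 0 <= cos a).
{ apply cos_ge_0; assert (h1 := PI2_1); unfold Rabs in ha; destruct (Rcase_abs a); lra. }
set (v := 2 * (cosh b - cos a)).
assert (v0 : 0 <= v) by (unfold v; assert (0 <= b ^ 2) by nra; lra).
set (eta := / (1 + 4 * r)).
assert (eta1 : 0 < eta <= 1).
{ unfold eta; split; [apply Rinv_0_lt_compat; lra|].
  rewrite <- Rinv_1; apply Rinv_le_contravar; lra. }
assert (etaE : eta * (1 + 4 * r) = 1) by (unfold eta; field; lra).
rewrite factor_sqr_expand; fold v.
(* The defect 2 (cosh b - 1)(1 + cos a) is at least 2 (cosh b - 1) as cos a >= 0, and this is at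
   least eta v since 2 (1 - cos a) <= r b^2 <= 8 r (cosh b - 1). *)
assert (gv : 2 - 2 * (cosh b * cos a) <= (1 - eta) * v).
{ assert (e : 2 - 2 * (cosh b * cos a) = v - 2 * ((cosh b - 1) * (1 + cos a))) by (unfold v; ring).
  assert (0 <= b ^ 2) by nra.
  assert (h1 : v <= (1 + 4 * r) * (2 * (cosh b - 1))) by (unfold v; nra).
  assert (h2 : eta * v <= 2 * (cosh b - 1)).
  { apply Rle_trans with (eta * ((1 + 4 * r) * (2 * (cosh b - 1)))).
    - apply Rmult_le_compat_l; lra.
    - rewrite <- Rmult_assoc, etaE; lra. }
  rewrite e; nra. }
apply Rle_trans with (exp (- (2 * (1 + 4 * r) * (s * v)))).
- assert (e : 2 * (1 + 4 * r) * (9 / 4 * y ^ 2 + r * y ^ 2) * h ^ 2 * s =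
    2 * (1 + 4 * r) * (s * ((9 / 4 + r) * b ^ 2))) by (unfold b; ring).
  rewrite e.
  assert (hv : v <= (9 / 4 + r) * b ^ 2) by (unfold v; nra).
  assert (h1 : s * v <= s * ((9 / 4 + r) * b ^ 2)) by (apply Rmult_le_compat_l; lra).
  assert (h2 : 2 * (1 + 4 * r) * (s * v) <= 2 * (1 + 4 * r) * (s * ((9 / 4 + r) * b ^ 2)))
    by (apply Rmult_le_compat_l; lra).
  destruct h2 as [h2|h2]; [left; apply exp_increasing; lra|right; rewrite h2; reflexivity].
(* With K = 2 / eta and g = 1 - eta, K (1 - g^2) = 4 - 2 eta >= 2. *)
- apply (quadratic_lower _ _ (1 - eta)); try lra.
  + apply Rmult_le_pos; lra.
  + replace ((1 - eta) * (s * v)) with (s * ((1 - eta) * v)) by ring.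
    apply Rmult_le_compat_l; lra.
  + nra.
Qed.

Lemma psum_0 n : psum (fun _ => 0) n = 0.
Proof. induction n; simpl; lra. Qed.

Lemma psum_ext f g n : (forall j, (1 <= j <= n)%nat -> f j = g j) -> psum f n = psum g n.
Proof.
induction n; intros e; simpl; [reflexivity|]; rewrite IHn, e; [reflexivity|lia|].
intros j hj; apply e; lia.
Qed.

Lemma cos_sum_im_0 N w b : cos_sum_im N w 0 b = 0.
Proof.
unfold cos_sum_im; rewrite (psum_ext _ (fun _ => 0)), psum_0; [ring|].
intros j _; rewrite Rmult_0_r, sin_0; ring.
Qed.

Lemma psum_pos f n : (forall j, (1 <= j <= n)%nat -> 0 <= f j) -> 0 <= psum f n.
Proof.
induction n; intros e; simpl; [lra|].
apply Rplus_le_le_0_compat; [apply IHn; intros; apply e; lia|apply e; lia].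
Qed.

Lemma cosh_pos b : 0 < cosh b.
Proof. unfold cosh; assert (h1 := exp_pos b); assert (h2 := exp_pos (- b)); lra. Qed.

Lemma cos_sum_re_pos N w b : (forall j, (j <= N)%nat -> 0 < w j) -> 0 < cos_sum_re N w 0 b.
Proof.
intros wpos; unfold cos_sum_re; apply Rplus_lt_le_0_compat; [apply wpos; lia|].
apply psum_pos; intros j hj; rewrite Rmult_0_r, cos_0.
assert (h := wpos j ltac:(lia)); assert (h' := cosh_pos (INR j * b)).
apply Rmult_le_pos; lra.
Qed.

(** The ratio in the exponent is F(i) / F(0), unchanged when F is multiplied by h. The constant 8 is
    2 from [factor_sqr_lower] times 4 from [key]. *)
Theorem cos_sum_lower_bound k m gs h N w x y :
  0 < k -> (1 <= m)%nat -> 0 < h -> (forall j, (j <= N)%nat -> 0 < w j) -> w (S N) = 0 ->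
  (forall j, (j <= N)%nat ->
    w j - w (S j) = (qpol k m gs (h * INR (S j)) - qpol k m gs (h * INR j)) / 2 * (w j + w (S j))) ->
  y <> 0 -> h * Rabs x <= 1 -> h * Rabs y <= 1 ->
  cos_sum_re N w 0 0 ^ 4 *
    exp (- (8 * (1 + 4 * x ^ 2 / y ^ 2) * (9 / 4 * y ^ 2 + x ^ 2) *
            ((cos_sum_re N w 0 h / cos_sum_re N w 0 0) ^ 2 - 1)))
  <= (cos_sum_re N w (h * x) (h * y) ^ 2 + cos_sum_im N w (h * x) (h * y) ^ 2) ^ 2.
Proof.
intros k0 m1 h0 wpos wN rec y0 hx hy.
destruct (Bridge.cos_sum_factor k m gs h N w k0 m1 h0 wpos wN rec) as [ss [ss0 ssE]].
rewrite ssE, cos_sum_im_0.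
assert (c0 := cos_sum_re_pos N w 0 wpos); assert (ch := cos_sum_re_pos N w h wpos).
set (c := cos_sum_re N w 0 0) in *; set (d := cos_sum_re N w 0 h) in *.
replace ((c ^ 2 + 0 ^ 2) ^ 2) with (c ^ 4) by ring.
apply Rmult_le_compat_l; [apply pow_le; lra|].
apply Rle_trans with
  (exp (- (2 * (1 + 4 * x ^ 2 / y ^ 2) * (9 / 4 * y ^ 2 + x ^ 2) * h ^ 2 * lsum ss))).
2: { apply prod_ge_exp; [|assumption]; intros s s0; apply factor_sqr_lower; assumption. }
(* At z = i every factor is the real number 1 + s t with t >= h^2 / 4, so their product Q = (d /
   c)^2 dominates 1 + t times the sum of the s. *)
assert (key : h ^ 2 / 4 * lsum ss <= (d / c) ^ 2 - 1).
{ assert (e := ssE 0 h); rewrite !cos_sum_im_0 in e; fold c d in e.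
  set (t := 2 * (cosh h - 1)).
  set (Q := fold_right (fun s acc => (1 + s * t) * acc) 1 ss).
  assert (t0 : h ^ 2 / 4 <= t) by (unfold t; assert (h1 := cosh_lower h); lra).
  assert (eQ : fold_right (fun s acc => factor_sqr 0 h s * acc) 1 ss = Q ^ 2).
  { unfold Q; clear; induction ss as [|s ss IH]; simpl fold_right; [ring|].
    rewrite IH; unfold factor_sqr, t; rewrite cos_0, sin_0; ring. }
  assert (Q1 : 1 + t * lsum ss <= Q).
  { unfold Q; clear -ss0 t0 h0; induction ss0 as [|s ss s0 hs IH]; simpl; [lra|].
    change (fold_right Rplus 0 ss) with (lsum ss).
    assert (h1 := lsum_ge_0 ss hs).
    assert (0 < t) by nra.
    assert (0 <= s * t) by (apply Rmult_le_pos; lra).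
    assert (0 <= t * lsum ss) by (apply Rmult_le_pos; lra).
    nra. }
  assert (l0 := lsum_ge_0 ss ss0).
  assert (Qpos : 1 <= Q) by nra.
  rewrite eQ in e.
  assert (e' : d ^ 2 = c ^ 2 * Q).
  { assert (f : (d ^ 2 - c ^ 2 * Q) * (d ^ 2 + c ^ 2 * Q) = 0) by nra.
    apply Rmult_integral in f; destruct f as [f|f]; [lra|].
    assert (0 < d ^ 2) by nra; assert (0 < c ^ 2 * Q) by nra; lra. }
  replace ((d / c) ^ 2) with Q; [nra|].
  unfold Rdiv; rewrite Rpow_mult_distr, e'; field; lra. }
assert (y2 : 0 < y ^ 2) by (assert (0 < y * y) by (apply Rlt_0_sqr in y0; exact y0); nra).
assert (p0 : 0 <= x ^ 2 / y ^ 2)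
  by (apply Rmult_le_pos; [nra|apply Rlt_le, Rinv_0_lt_compat; lra]).
replace (4 * x ^ 2 / y ^ 2) with (4 * (x ^ 2 / y ^ 2)) by (field; lra).
set (A := (1 + 4 * (x ^ 2 / y ^ 2)) * (9 / 4 * y ^ 2 + x ^ 2)).
assert (A0 : 0 <= A) by (unfold A; apply Rmult_le_pos; nra).
assert (h1 : 8 * A * (h ^ 2 / 4 * lsum ss) <= 8 * A * ((d / c) ^ 2 - 1))
  by (apply Rmult_le_compat_l; lra).
match goal with |- exp ?u <= exp ?v => assert (uv : u <= v) end.
{ unfold A in h1; lra. }
destruct uv as [uv|uv]; [left; apply exp_increasing; exact uv|right; rewrite uv; reflexivity].
Qed.

(** * Approximating polynomials, mesh and weights *)

Definition quad_prod (gs : list R) (x : R) : R :=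
  fold_right (fun g acc => (1 + g ^ 2 * x ^ 2) * acc) 1 gs.

Lemma quad_prod_cons g gs x : quad_prod (g :: gs) x = (1 + g ^ 2 * x ^ 2) * quad_prod gs x.
Proof. reflexivity. Qed.

Lemma quad_prod_app l1 l2 x : quad_prod (l1 ++ l2) x = quad_prod l1 x * quad_prod l2 x.
Proof.
induction l1 as [|g l IH]; simpl app; [unfold quad_prod; simpl; ring|].
rewrite !quad_prod_cons, IH; ring.
Qed.

Lemma quad_prod_repeat g n x : quad_prod (repeat g n) x = (1 + g ^ 2 * x ^ 2) ^ n.
Proof.
induction n as [|n IH]; [reflexivity|]; simpl repeat.
rewrite quad_prod_cons, IH; reflexivity.
Qed.

Lemma quad_prod_ge_1 gs x : 1 <= quad_prod gs x.
Proof.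
induction gs as [|g gs IH]; [unfold quad_prod; simpl; lra|]; rewrite quad_prod_cons.
assert (0 <= g ^ 2 * x ^ 2) by (apply Rmult_le_pos; apply pow2_ge_0); nra.
Qed.

(* Nonnegative, nondecreasing and convex on [0, +oo), in a form closed under products. *)
Definition convex_incr (g : R -> R) : Prop := forall s t d, 0 <= s <= t -> 0 < d ->
  0 <= g s <= g t /\ d * (g t - g s) <= (t - s) * (g (t + d) - g t).

(** Product rule for increments: the increment before t is split with [f t] and [g s], the one after
    t with [f t] and [g (t + d)]. The surplus [h3] is nonnegative by monotonicity. *)
Lemma convex_incr_mul f g : convex_incr f -> convex_incr g ->
  convex_incr (fun x => f x * g x).
Proof.
intros hf hg s t d st d0.
destruct (hf s t d st d0) as [[f0 f1] f2]; destruct (hg s t d st d0) as [[g0 g1] g2].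
destruct (hf t (t + d) d ltac:(lra) d0) as [[_ f3] _].
destruct (hg t (t + d) d ltac:(lra) d0) as [[_ g3] _].
split; [split; [apply Rmult_le_pos; lra|apply Rmult_le_compat; lra]|].
assert (h1 : f t * (d * (g t - g s)) <= f t * ((t - s) * (g (t + d) - g t)))
  by (apply Rmult_le_compat_l; lra).
assert (h2 : g s * (d * (f t - f s)) <= g s * ((t - s) * (f (t + d) - f t)))
  by (apply Rmult_le_compat_l; lra).
assert (h3 : 0 <= (t - s) * (f (t + d) - f t) * (g (t + d) - g s))
  by (apply Rmult_le_pos; [apply Rmult_le_pos|]; lra).
lra.
Qed.

Lemma convex_incr_const c : 0 <= c -> convex_incr (fun _ => c).
Proof. intros c0 s t d st d0; lra. Qed.

Lemma convex_incr_id : convex_incr (fun x => x).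
Proof. intros s t d st d0; nra. Qed.

Lemma convex_incr_pow n : convex_incr (fun x => x ^ n).
Proof.
induction n; simpl; [apply convex_incr_const; lra|].
apply convex_incr_mul; [apply convex_incr_id|assumption].
Qed.

Lemma convex_incr_quad g : convex_incr (fun x => 1 + g ^ 2 * x ^ 2).
Proof.
intros s t d st d0; assert (g0 := pow2_ge_0 g); set (c := g ^ 2) in *.
destruct (convex_incr_pow 2 s t d st d0) as [[h0 h1] h2].
split; [split; nra|].
assert (h3 : c * (d * (t ^ 2 - s ^ 2)) <= c * ((t - s) * ((t + d) ^ 2 - t ^ 2)))
  by (apply Rmult_le_compat_l; lra).
lra.
Qed.

Lemma convex_incr_quad_prod gs : convex_incr (quad_prod gs).
Proof.
unfold quad_prod; induction gs as [|g gs IH]; simpl fold_right.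
- apply convex_incr_const; lra.
- apply (convex_incr_mul _ _ (convex_incr_quad g) IH).
Qed.

Lemma convex_incr_qpol k m gs : 0 <= k -> convex_incr (qpol k m gs).
Proof.
intros k0; apply convex_incr_mul; [|apply convex_incr_quad_prod].
apply convex_incr_mul; [apply convex_incr_const; lra|apply convex_incr_pow].
Qed.

(** A factor x^2 is split off: its increments 2 t d - d^2 and 2 t d + d^2 differ strictly, the
    cofactor G being convex. Strictness keeps all half-steps before the last one below 1. *)
Lemma qpol_strict k m gs t d : 0 < k -> (1 <= m)%nat -> 0 < d -> d <= t ->
  qpol k m gs t - qpol k m gs (t - d) < qpol k m gs (t + d) - qpol k m gs t.
Proof.
intros k0 m1 d0 dt; destruct m as [|m]; [lia|].
assert (e : forall x, qpol k (S m) gs x = x ^ 2 * (k * x ^ (2 * m) * quad_prod gs x)).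
{ intros x; unfold qpol, quad_prod; replace (2 * S m)%nat with (2 + 2 * m)%nat by lia.
  rewrite pow_add; ring. }
rewrite !e.
assert (cg : convex_incr (fun x => k * x ^ (2 * m) * quad_prod gs x))
  by exact (convex_incr_qpol k m gs (Rlt_le _ _ k0)).
assert (gt : 0 < k * t ^ (2 * m) * quad_prod gs t).
{ assert (h := quad_prod_ge_1 gs t).
  assert (0 < t ^ (2 * m)) by (apply pow_lt; lra).
  apply Rmult_lt_0_compat; [apply Rmult_lt_0_compat|]; lra. }
destruct (cg (t - d) t d ltac:(lra) d0) as [[g0 g1] g2].
destruct (cg t (t + d) d ltac:(lra) d0) as [[_ g3] _].
cbv beta in *; set (G := fun x => k * x ^ (2 * m) * quad_prod gs x) in *.
change (k * (t - d) ^ (2 * m) * quad_prod gs (t - d)) with (G (t - d)) in *.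
change (k * (t + d) ^ (2 * m) * quad_prod gs (t + d)) with (G (t + d)) in *.
change (k * t ^ (2 * m) * quad_prod gs t) with (G t) in *.
assert (g4 : G t - G (t - d) <= G (t + d) - G t).
{ apply Rmult_le_reg_l with d; [lra|]; replace (t - (t - d)) with d in g2 by ring; lra. }
assert (a1 : (t - d) ^ 2 * (G t - G (t - d)) <= t ^ 2 * (G (t + d) - G t))
  by (apply Rmult_le_compat; [apply pow2_ge_0|lra|apply pow_incr; lra|lra]).
assert (a2 : (2 * t * d - d ^ 2) * G t < (2 * t * d + d ^ 2) * G t)
  by (apply Rmult_lt_compat_r; [lra|]; assert (0 < d ^ 2) by (apply pow_lt; lra); lra).
assert (a3 : (2 * t * d + d ^ 2) * G t <= (2 * t * d + d ^ 2) * G (t + d))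
  by (apply Rmult_le_compat_l; [|lra]; nra).
nra.
Qed.

Lemma qpol_0 k m gs : (1 <= m)%nat -> qpol k m gs 0 = 0.
Proof. intros m1; unfold qpol; rewrite pow_i by lia; ring. Qed.

Lemma qpol_lower k m gs t : 0 <= k -> k * t ^ (2 * m) <= qpol k m gs t.
Proof.
intros k0; unfold qpol; change (fold_right _ 1 gs) with (quad_prod gs t).
assert (h := quad_prod_ge_1 gs t).
assert (0 <= k * t ^ (2 * m)) by (apply Rmult_le_pos; [lra|rewrite pow_mult; apply pow_le, pow2_ge_0]).
nra.
Qed.

Lemma continuity_qpol k m gs : continuity (qpol k m gs).
Proof.
assert (hp : forall n, continuity (fun x => x ^ n))
  by (intros n; apply derivable_continuous, derivable_pow).
unfold qpol; apply continuity_mult.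
- apply continuity_mult; [apply continuity_const; red; reflexivity|apply hp].
- induction gs as [|g gs IH]; simpl fold_right; [apply continuity_const; red; reflexivity|].
  apply (continuity_mult (fun x => 1 + g ^ 2 * x ^ 2)); [|exact IH].
  apply (continuity_plus (fun _ => 1) (fun x => g ^ 2 * x ^ 2));
    [apply continuity_const; red; reflexivity|].
  apply (continuity_mult (fun _ => g ^ 2)); [apply continuity_const; red; reflexivity|apply hp].
Qed.

(** The bound rests on (N + 1)^(2 i) - N^(2 i) >= 2 N + 1. Its linear growth in N forces the mesh to
    shrink. *)
Lemma qpol_step_lower k m gs h N : 0 < k -> (1 <= m)%nat -> 0 < h ->
  k * h ^ (2 * m) * (2 * INR N + 1) <=
  qpol k m gs (h * INR (S N)) - qpol k m gs (h * INR N).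
Proof.
intros k0 m1 h0; assert (N0 := pos_INR N).
assert (hN : 0 <= h * INR N) by (apply Rmult_le_pos; lra).
set (a := h * INR N) in *; replace (h * INR (S N)) with (a + h) by (rewrite S_INR; unfold a; ring).
destruct (convex_incr_quad_prod gs a (a + h) h ltac:(lra) h0) as [[_ q1] _].
assert (q0 := quad_prod_ge_1 gs a).
unfold qpol; change (fold_right _ 1 gs) with (quad_prod gs a) at 2.
change (fold_right (fun g acc => (1 + g ^ 2 * (a + h) ^ 2) * acc) 1 gs) with (quad_prod gs (a + h)).
assert (p : h ^ (2 * m) * (2 * INR N + 1) <= (a + h) ^ (2 * m) - a ^ (2 * m)).
{ unfold a; replace (h * INR N + h) with (h * (INR N + 1)) by ring; rewrite !Rpow_mult_distr.
  assert (e : forall i, (i >= 1)%nat -> 2 * INR N + 1 <= (INR N + 1) ^ (2 * i) - INR N ^ (2 * i)).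
  { intros i i1; induction i as [|i IH]; [lia|].
    destruct i as [|i]; [simpl; nra|].
    specialize (IH ltac:(lia)).
    replace (2 * S (S i))%nat with (2 + 2 * S i)%nat by lia; rewrite !pow_add.
    set (u := (INR N + 1) ^ (2 * S i)) in *; set (v := INR N ^ (2 * S i)) in *.
    assert (0 <= v) by (unfold v; apply pow_le; lra).
    assert (1 <= (INR N + 1) ^ 2) by nra.
    assert (INR N ^ 2 <= (INR N + 1) ^ 2) by nra.
    nra. }
  rewrite <- Rmult_minus_distr_l; apply Rmult_le_compat_l; [apply pow_le; lra|apply e; lia]. }
assert (0 <= a ^ (2 * m)) by (apply pow_le; lra).
assert (0 <= h ^ (2 * m)) by (apply pow_le; lra).
assert (p' : k * (h ^ (2 * m) * (2 * INR N + 1)) <= k * ((a + h) ^ (2 * m) - a ^ (2 * m)))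
  by (apply Rmult_le_compat_l; lra).
set (Q := quad_prod gs (a + h)) in *; set (q := quad_prod gs a) in *.
assert (0 <= k * a ^ (2 * m)) by (apply Rmult_le_pos; lra).
assert (k * a ^ (2 * m) * q <= k * a ^ (2 * m) * Q) by (apply Rmult_le_compat_l; lra).
assert (0 <= k * ((a + h) ^ (2 * m) - a ^ (2 * m))).
{ apply Rle_trans with (2 := p'); apply Rmult_le_pos; [lra|apply Rmult_le_pos; lra]. }
assert (k * ((a + h) ^ (2 * m) - a ^ (2 * m)) * 1 <= k * ((a + h) ^ (2 * m) - a ^ (2 * m)) * Q)
  by (apply Rmult_le_compat_l; lra).
lra.
Qed.

(** The value 2 means A_(N+1) = 1. The increment is 0 at h = 0 and exceeds 2 for large h. A sigma
    type makes the mesh a function of N. *)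
Lemma exists_step k m gs N : 0 < k -> (1 <= m)%nat ->
  {h | 0 < h /\ qpol k m gs (h * INR (S N)) - qpol k m gs (h * INR N) = 2}.
Proof.
intros k0 m1.
set (D := fun h => qpol k m gs (h * INR (S N)) - qpol k m gs (h * INR N) - 2).
assert (cD : continuity D).
{ assert (c : forall a, continuity (fun h => qpol k m gs (h * a))).
  { intros a; apply (continuity_comp (fun h => h * a)); [|apply continuity_qpol].
    apply (continuity_mult id (fun _ => a));
      [apply derivable_continuous, derivable_id|apply continuity_const; red; reflexivity]. }
  unfold D; apply continuity_minus; [apply continuity_minus; apply c|].
  apply continuity_const; red; reflexivity. }
(* k H = k + 2 > 2, and H >= 1 gives H <= H^(2 m). *)
set (H := 1 + 2 / k).
assert (k2 : 0 < 2 / k) by (apply Rdiv_lt_0_compat; lra).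
assert (DH : 0 < D H).
{ assert (h1 := qpol_step_lower k m gs H N k0 m1 ltac:(unfold H; lra)).
  assert (h2 : H <= H ^ (2 * m)).
  { rewrite <- (pow_1 H) at 1; apply Rle_pow; [unfold H; lra|lia]. }
  assert (kH : k * H = k + 2) by (unfold H; field; lra).
  assert (k * H <= k * H ^ (2 * m)) by (apply Rmult_le_compat_l; lra).
  assert (N0 := pos_INR N).
  unfold D; nra. }
assert (D0 : D 0 < 0) by (unfold D; rewrite !Rmult_0_l, qpol_0 by assumption; lra).
destruct (IVT D 0 H cD ltac:(unfold H; lra) D0 DH) as [h [[h0 h1] hD]].
exists h; split; [|unfold D in hD; lra].
destruct h0 as [h0|h0]; [exact h0|rewrite <- h0 in hD; lra].
Qed.

(** Equivalent to (1 - A) exp A <= (1 + A) exp (- A); the difference vanishes at 0 and has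
    derivative t (exp t - exp (- t)) >= 0. *)
Lemma cayley_le_exp A : 0 < A -> (1 - A) / (1 + A) <= exp (- (2 * A)).
Proof.
intros A0.
set (g := fun t => (1 + t) * exp (- t) - (1 - t) * exp t).
set (g' := fun t => t * (exp t - exp (- t))).
assert (dg : forall c, 0 <= c <= A -> derivable_pt_lim g c (g' c)).
{ intros c _; apply is_derive_Reals; unfold g, g'; auto_derive; [trivial|ring]. }
destruct (MVT_cor2 g g' 0 A A0 dg) as [c [e c0]].
assert (0 <= g' c * (A - 0)).
{ unfold g'; assert (h := exp_sub_exp_neg c ltac:(lra)).
  apply Rmult_le_pos; [apply Rmult_le_pos; lra|lra]. }
assert (g0 : g 0 = 0) by (unfold g; rewrite Ropp_0; ring).
assert (gA : 0 <= g A) by lra; unfold g in gA.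
apply Rmult_le_reg_l with ((1 + A) * exp A);
  [apply Rmult_lt_0_compat; [lra|apply exp_pos]|].
replace ((1 + A) * exp A * ((1 - A) / (1 + A))) with ((1 - A) * exp A) by (field; lra).
replace (- (2 * A)) with (- A + - A) by ring; rewrite exp_plus.
assert (e1 : exp A * exp (- A) = 1) by (rewrite <- exp_plus, Rplus_opp_r, exp_0; reflexivity).
replace ((1 + A) * exp A * (exp (- A) * exp (- A)))
  with ((1 + A) * exp (- A) * (exp A * exp (- A))) by ring.
rewrite e1; lra.
Qed.

(** The relative loss 1 + 2 a in the exponent tends to 1 with the mesh; a <= 1/2 is what (1 - a)(1 +
    2 a) >= 1 requires. *)
Lemma cayley_ge_exp A a : 0 < A <= a -> a <= / 2 ->
  exp (- ((1 + 2 * a) * (2 * A))) <= (1 - A) / (1 + A).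
Proof.
intros A0 a2; rewrite exp_Ropp.
assert (h := exp_ineq1_le ((1 + 2 * a) * (2 * A))).
assert (h1 : (1 + A) <= (1 - A) * (1 + (1 + 2 * a) * (2 * A))).
{ assert (1 <= (1 - A) * (1 + 2 * a)) by nra; nra. }
assert (h2 : 0 < 1 + (1 + 2 * a) * (2 * A)) by nra.
apply Rle_trans with (/ (1 + (1 + 2 * a) * (2 * A))); [apply Rinv_le_contravar; lra|].
apply Rmult_le_reg_l with (1 + (1 + 2 * a) * (2 * A)); [lra|]; rewrite Rinv_r by lra.
apply Rmult_le_reg_l with (1 + A); [lra|].
replace ((1 + A) * ((1 + (1 + 2 * a) * (2 * A)) * ((1 - A) / (1 + A))))
  with ((1 - A) * (1 + (1 + 2 * a) * (2 * A))) by (field; lra).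
lra.
Qed.

(** * Weights generated by the Cayley recurrence *)

Section Weights.
Variables (k : R) (m : nat) (gs : list R) (h : R) (N : nat).
Hypotheses (k0 : 0 < k) (m1 : (1 <= m)%nat) (h0 : 0 < h).
Hypothesis step : qpol k m gs (h * INR (S N)) - qpol k m gs (h * INR N) = 2.

(** The index is shifted: [half_step j] is A_(j+1), so [step] says [half_step N = 1]. *)
Definition half_step (j : nat) : R :=
  (qpol k m gs (h * INR (S j)) - qpol k m gs (h * INR j)) / 2.

Fixpoint weight (j : nat) : R :=
  match j with O => 1 | S i => weight i * ((1 - half_step i) / (1 + half_step i)) end.

Lemma half_step_lt j : half_step j < half_step (S j).
Proof.
unfold half_step; assert (j0 := pos_INR j).
assert (s := qpol_strict k m gs (h * INR (S j)) h k0 m1 h0 ltac:(rewrite S_INR; nra)).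
replace (h * INR (S j) - h) with (h * INR j) in s by (rewrite S_INR; ring).
replace (h * INR (S j) + h) with (h * INR (S (S j))) in s by (rewrite (S_INR (S j)); ring).
lra.
Qed.

Lemma half_step_pos j : 0 < half_step j.
Proof.
unfold half_step; assert (s := qpol_step_lower k m gs h j k0 m1 h0).
assert (0 < k * h ^ (2 * m) * (2 * INR j + 1)).
{ assert (j0 := pos_INR j); apply Rmult_lt_0_compat; [|lra].
  apply Rmult_lt_0_compat; [lra|apply pow_lt; lra]. }
lra.
Qed.

Lemma half_step_mono i j : (i < j)%nat -> half_step i < half_step j.
Proof.
induction 1 as [|j ij IH]; [apply half_step_lt|].
apply Rlt_trans with (1 := IH), half_step_lt.
Qed.

Lemma half_step_lt_1 j : (j < N)%nat -> half_step j < 1.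
Proof.
assert (hN : half_step N = 1) by (unfold half_step; lra).
intros jN; rewrite <- hN; apply half_step_mono, jN.
Qed.

Lemma weight_pos j : (j <= N)%nat -> 0 < weight j.
Proof.
induction j as [|j IH]; simpl; intros jN; [lra|].
assert (h1 := half_step_lt_1 j ltac:(lia)); assert (h2 := half_step_pos j).
apply Rmult_lt_0_compat; [apply IH; lia|apply Rdiv_lt_0_compat; lra].
Qed.

Lemma weight_last : weight (S N) = 0.
Proof.
simpl; replace (half_step N) with 1 by (unfold half_step; lra); field.
Qed.

Lemma weight_rec j : weight j - weight (S j) = half_step j * (weight j + weight (S j)).
Proof. assert (h2 := half_step_pos j); simpl; field; lra. Qed.

Lemma qpol_telescope j :
  qpol k m gs (h * INR (S j)) = qpol k m gs (h * INR j) + 2 * half_step j.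
Proof. unfold half_step; field. Qed.

(** The exponents 2 A_i telescope to q(h j) because q(0) = 0. *)
Lemma weight_upper j : (j <= N)%nat -> weight j <= exp (- qpol k m gs (h * INR j)).
Proof.
induction j as [|j IH]; intros jN.
- rewrite Rmult_0_r, qpol_0, Ropp_0, exp_0 by assumption; simpl; lra.
- assert (h1 := half_step_lt_1 j ltac:(lia)); assert (h2 := half_step_pos j).
  rewrite qpol_telescope; simpl weight.
  set (A := half_step j) in *.
  rewrite Ropp_plus_distr, exp_plus.
  apply Rmult_le_compat; [apply Rlt_le, weight_pos; lia| |apply IH; lia|].
  + apply Rlt_le, Rdiv_lt_0_compat; lra.
  + apply cayley_le_exp; lra.
Qed.

Lemma weight_lower a j : a <= / 2 -> (forall i, (i < j)%nat -> half_step i <= a) ->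
  exp (- ((1 + 2 * a) * qpol k m gs (h * INR j))) <= weight j.
Proof.
intros a2; induction j as [|j IH]; intros ha.
- rewrite Rmult_0_r, qpol_0, Rmult_0_r, Ropp_0, exp_0 by assumption; simpl; lra.
- assert (h2 := half_step_pos j); assert (h1 := ha j ltac:(lia)).
  rewrite qpol_telescope; simpl weight.
  rewrite Rmult_plus_distr_l, Ropp_plus_distr, exp_plus.
  apply Rmult_le_compat; try (apply Rlt_le, exp_pos).
  + apply IH; intros; apply ha; lia.
  + apply cayley_ge_exp; lra.
Qed.

End Weights.

(** * Even polynomials increasing to q, with an explicit error *)

Section Approximants.
Variables (k mu : R) (m : nat) (Nb : option nat) (beta : nat -> R) (q : R -> R).
Hypotheses (k0 : k > 0) (mu0 : mu >= 0).
Hypothesis hq : is_q k mu m Nb beta q.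

Fixpoint inv_betas (N : nat) : list R :=
  match N with
  | O => nil
  | S n => inv_betas n ++ (if in_idx Nb n then (/ beta n) :: nil else nil)
  end.

(** The repeated entries produce (1 + mu x^2 / N)^N, which replaces exp (mu x^2) and keeps the zeros
    imaginary. *)
Definition apx_list (N : nat) : list R := inv_betas N ++ repeat (sqrt (mu / INR N)) N.

Definition apx (N : nat) : R -> R := qpol k m (apx_list N).

Fixpoint beta_sum (N : nat) : R :=
  match N with
  | O => 0
  | S n => beta_sum n + (if in_idx Nb n then / (beta n) ^ 2 else 0)
  end.

Hypothesis hb : forall n, in_idx Nb n = true -> beta n <> 0.

Lemma quad_prod_inv_betas N x : quad_prod (inv_betas N) x = pprod Nb beta N x.
Proof.
induction N as [|n IH]; [reflexivity|].
simpl inv_betas; simpl pprod; rewrite quad_prod_app, IH; f_equal.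
destruct (in_idx Nb n) eqn:e; [|reflexivity].
rewrite quad_prod_cons; unfold quad_prod; simpl fold_right; field; auto.
Qed.

Lemma apx_eq N x : (1 <= N)%nat ->
  apx N x = k * x ^ (2 * m) * pprod Nb beta N x * (1 + mu * x ^ 2 / INR N) ^ N.
Proof.
intros N1; assert (N0 : 0 < INR N) by (apply lt_0_INR; lia).
unfold apx, qpol, apx_list; change (fold_right _ 1 ?l) with (quad_prod l x).
rewrite quad_prod_app, quad_prod_inv_betas, quad_prod_repeat, pow2_sqrt.
- replace (mu / INR N * x ^ 2) with (mu * x ^ 2 / INR N) by (field; lra); ring.
- apply Rmult_le_pos; [lra|apply Rlt_le, Rinv_0_lt_compat; lra].
Qed.

Lemma exp_pow_INR a n : exp a ^ n = exp (INR n * a).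
Proof.
induction n as [|n IH]; [simpl; rewrite Rmult_0_l, exp_0; reflexivity|].
rewrite S_INR, Rmult_plus_distr_r, exp_plus, Rmult_1_l, <- IH; simpl; ring.
Qed.

(** With y = X / N, the lower bound is exp (y - y^2) <= 1 + y, which follows from (1 + y)(1 - y +
    y^2) = 1 + y^3 >= 1. *)
Lemma pow_exp_bounds X N : 0 <= X -> (1 <= N)%nat ->
  exp (X - X ^ 2 / INR N) <= (1 + X / INR N) ^ N <= exp X.
Proof.
intros X0 N1; assert (N0 : 0 < INR N) by (apply lt_0_INR; lia).
set (y := X / INR N); assert (y0 : 0 <= y)
  by (apply Rmult_le_pos; [lra|apply Rlt_le, Rinv_0_lt_compat; lra]).
split.
- replace (X - X ^ 2 / INR N) with (INR N * (y - y ^ 2)) by (unfold y; field; lra).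
  rewrite <- exp_pow_INR; apply pow_incr; split; [apply Rlt_le, exp_pos|].
  assert (h := exp_ineq1_le (- (y - y ^ 2))); rewrite exp_Ropp in h.
  assert (h1 : 0 < exp (y - y ^ 2)) by apply exp_pos.
  assert (h2 : exp (y - y ^ 2) * (1 + - (y - y ^ 2)) <= 1).
  { apply Rmult_le_compat_l with (r := exp (y - y ^ 2)) in h; [|lra].
    rewrite Rinv_r in h by lra; lra. }
  assert (1 <= (1 + y) * (1 + - (y - y ^ 2))).
  { assert (0 <= y ^ 3) by (apply pow_le; lra).
    replace ((1 + y) * (1 + - (y - y ^ 2))) with (1 + y ^ 3) by ring; lra. }
  assert (0 < 1 + - (y - y ^ 2)) by nra.
  apply Rmult_le_reg_r with (1 + - (y - y ^ 2)); lra.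
- replace X with (INR N * y) by (unfold y; field; lra).
  rewrite <- exp_pow_INR; apply pow_incr; split; [lra|apply exp_ineq1_le].
Qed.

Lemma pprod_ge_1 N x : 1 <= pprod Nb beta N x.
Proof. rewrite <- quad_prod_inv_betas; apply quad_prod_ge_1. Qed.

Lemma pprod_growing x : Un_growing (fun N => pprod Nb beta N x).
Proof.
intros n; rewrite <- !quad_prod_inv_betas; simpl inv_betas; rewrite quad_prod_app.
assert (h := quad_prod_ge_1 (inv_betas n) x).
assert (h' := quad_prod_ge_1 (if in_idx Nb n then / beta n :: nil else nil) x).
nra.
Qed.

Lemma beta_sum_growing : Un_growing beta_sum.
Proof.
intros n; cbn [beta_sum]; destruct (in_idx Nb n); [|lra].
assert (h := pow2_ge_0 (/ beta n)); rewrite pow_inv in h; lra.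
Qed.

Lemma pprod_tail N M x : (N <= M)%nat ->
  pprod Nb beta M x <= pprod Nb beta N x * exp (x ^ 2 * (beta_sum M - beta_sum N)).
Proof.
induction 1 as [|M NM IH].
- rewrite Rminus_diag, Rmult_0_r, exp_0; lra.
- cbn [pprod beta_sum].
  assert (p1 := pprod_ge_1 M x); assert (p2 := pprod_ge_1 N x).
  destruct (in_idx Nb M) eqn:e.
  + replace (x ^ 2 * (beta_sum M + / beta M ^ 2 - beta_sum N)) with
      (x ^ 2 * (beta_sum M - beta_sum N) + x ^ 2 / beta M ^ 2) by (field; auto).
    rewrite exp_plus, <- Rmult_assoc; apply Rmult_le_compat; try lra.
    * assert (h := pow2_ge_0 (x / beta M)).
      unfold Rdiv in *; rewrite Rpow_mult_distr, pow_inv in h; lra.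
    * apply exp_ineq1_le.
  + replace (beta_sum M + 0 - beta_sum N) with (beta_sum M - beta_sum N) by ring.
    lra.
Qed.

Lemma q_main_nonneg t : 0 <= k * t ^ (2 * m) * exp (mu * t ^ 2).
Proof.
assert (h := exp_pos (mu * t ^ 2)); apply Rmult_le_pos; [|lra].
apply Rmult_le_pos; [lra|rewrite pow_mult; apply pow_le, pow2_ge_0].
Qed.

Lemma apx_le_q N t : (1 <= N)%nat -> apx N t <= q t.
Proof.
intros N1; rewrite apx_eq by assumption.
assert (X0 : 0 <= mu * t ^ 2) by (apply Rmult_le_pos; [lra|apply pow2_ge_0]).
destruct (pow_exp_bounds (mu * t ^ 2) N X0 N1) as [_ h].
assert (h1 : k * t ^ (2 * m) * exp (mu * t ^ 2) * pprod Nb beta N t <= q t).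
{ apply (growing_ineq (fun N => k * t ^ (2 * m) * exp (mu * t ^ 2) * pprod Nb beta N t)); [|apply hq].
  intros n; apply Rmult_le_compat_l; [apply q_main_nonneg|apply pprod_growing]. }
apply Rle_trans with (2 := h1).
assert (p1 := pprod_ge_1 N t).
assert (0 <= k * t ^ (2 * m)) by (apply Rmult_le_pos; [lra|rewrite pow_mult; apply pow_le, pow2_ge_0]).
replace (k * t ^ (2 * m) * exp (mu * t ^ 2) * pprod Nb beta N t)
  with (k * t ^ (2 * m) * pprod Nb beta N t * exp (mu * t ^ 2)) by ring.
apply Rmult_le_compat_l; [apply Rmult_le_pos; lra|exact h].
Qed.

Variable s : R.
Hypothesis hs : Un_cv beta_sum s.

(** Logarithmic error of the approximant: the loss in (1 + X / N)^N plus the tail of the product. *)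
Definition apx_err (N : nat) (t : R) : R :=
  (mu * t ^ 2) ^ 2 / INR N + t ^ 2 * (s - beta_sum N).

Lemma q_le_apx N t : (1 <= N)%nat -> q t <= apx N t * exp (apx_err N t).
Proof.
intros N1; rewrite apx_eq by assumption.
assert (X0 : 0 <= mu * t ^ 2) by (apply Rmult_le_pos; [lra|apply pow2_ge_0]).
destruct (pow_exp_bounds (mu * t ^ 2) N X0 N1) as [h _].
assert (p1 := pprod_ge_1 N t); assert (c0 := q_main_nonneg t).
assert (h1 : q t <= k * t ^ (2 * m) * exp (mu * t ^ 2) *
   (pprod Nb beta N t * exp (t ^ 2 * (s - beta_sum N)))).
{ refine (is_lim_seq_le_loc _ (fun _ => _) (q t) (Finite _) _ (proj2 (is_lim_seq_Reals _ _) (hq t)) (is_lim_seq_const _)).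
  exists N; intros M NM; apply Rmult_le_compat_l; [assumption|].
  apply Rle_trans with (1 := pprod_tail N M t NM); apply Rmult_le_compat_l; [lra|].
  assert (b := growing_ineq _ _ beta_sum_growing hs M).
  assert (u : t ^ 2 * (beta_sum M - beta_sum N) <= t ^ 2 * (s - beta_sum N))
    by (apply Rmult_le_compat_l; [apply pow2_ge_0|lra]).
  destruct u as [u|u]; [left; apply exp_increasing; exact u|right; rewrite u; reflexivity]. }
apply Rle_trans with (1 := h1).
assert (0 <= k * t ^ (2 * m)) by (apply Rmult_le_pos; [lra|rewrite pow_mult; apply pow_le, pow2_ge_0]).
unfold apx_err; rewrite exp_plus.
assert (e : exp (mu * t ^ 2) = exp (mu * t ^ 2 - (mu * t ^ 2) ^ 2 / INR N) * exp ((mu * t ^ 2) ^ 2 / INR N))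
  by (rewrite <- exp_plus; f_equal; ring).
rewrite e.
set (E1 := exp (mu * t ^ 2 - _)) in *; set (E2 := exp ((mu * t ^ 2) ^ 2 / INR N)).
set (E3 := exp (t ^ 2 * _)).
assert (0 < E2) by apply exp_pos; assert (0 < E3) by apply exp_pos.
replace (k * t ^ (2 * m) * (E1 * E2) * (pprod Nb beta N t * E3))
  with (k * t ^ (2 * m) * pprod Nb beta N t * E2 * E3 * E1) by ring.
replace (k * t ^ (2 * m) * pprod Nb beta N t * (1 + mu * t ^ 2 / INR N) ^ N * (E2 * E3))
  with (k * t ^ (2 * m) * pprod Nb beta N t * E2 * E3 * (1 + mu * t ^ 2 / INR N) ^ N) by ring.
apply Rmult_le_compat_l; [|exact h].
repeat apply Rmult_le_pos; try lra.
rewrite pow_mult; apply pow_le, pow2_ge_0.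
Qed.

End Approximants.

(** * Improper integrals and Riemann sums *)

Lemma continuity_ex_RInt f a b : continuity f -> ex_RInt f a b.
Proof.
intros cf; apply (ex_RInt_continuous (V := R_CompleteNormedModule)).
intros z _; apply continuity_pt_filterlim, cf.
Qed.

(** Integral over [0, +oo) along integer endpoints. Being total, it is meaningful only where the
    limit exists and is finite, as [half_int_lim] shows under [exp_decay]. *)
Definition half_int (f : R -> R) : R := real (Lim_seq (fun n => RInt f 0 (INR n))).

Lemma half_int_ext f g : (forall t, f t = g t) -> half_int f = half_int g.
Proof.
intros e; unfold half_int; f_equal; apply Lim_seq_ext; intros n.
apply RInt_ext; intros; apply e.
Qed.

Definition exp_decay (M : R) (f : R -> R) : Prop :=
  continuity f /\ forall t, 0 <= t -> Rabs (f t) <= M * exp (- t).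

Lemma RInt_tail M f a b : exp_decay M f -> 0 <= a <= b ->
  Rabs (RInt f a b) <= M * exp (- a) - M * exp (- b).
Proof.
intros [cf hf] ab.
assert (I : is_RInt (fun t => M * exp (- t)) a b (M * exp (- a) - M * exp (- b))).
{ replace (M * exp (- a) - M * exp (- b)) with (minus (- (M * exp (- b))) (- (M * exp (- a))))
    by (unfold minus, plus, opp; simpl; ring).
  apply (is_RInt_derive (fun t => - (M * exp (- t)))).
  - intros x _; auto_derive; [trivial|ring].
  - intros x _; apply continuity_pt_filterlim.
    apply (continuity_mult (fun _ => M) (fun t => exp (- t)));
      [apply continuity_const; red; reflexivity|].
    apply (continuity_comp (fun t => - t) exp);
      [apply continuity_opp, derivable_continuous, derivable_id|
       apply derivable_continuous, derivable_exp]. }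
rewrite <- (is_RInt_unique _ _ _ _ I).
apply Rle_trans with (RInt (fun t => Rabs (f t)) a b).
- apply abs_RInt_le; [lra|apply continuity_ex_RInt, cf].
- apply RInt_le; [lra| |exists (M * exp (- a) - M * exp (- b)); exact I|intros; apply hf; lra].
  apply continuity_ex_RInt; apply (continuity_comp f Rabs); [exact cf|apply Rcontinuity_abs].
Qed.

Lemma exp_decay_nonneg M f : exp_decay M f -> 0 <= M.
Proof.
intros [_ hf]; assert (h := hf 0 (Rle_refl 0)); rewrite Ropp_0, exp_0 in h.
assert (h' := Rabs_pos (f 0)); lra.
Qed.

Lemma exp_neg_le_inv t : 0 <= t -> exp (- t) <= / (1 + t).
Proof.
intros t0; rewrite exp_Ropp; apply Rinv_le_contravar; [lra|apply exp_ineq1_le].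
Qed.

Lemma RInt_Chasles_R f a b c : continuity f -> RInt f a b + RInt f b c = RInt f a c.
Proof.
intros cf; apply (RInt_Chasles (V := R_CompleteNormedModule)); apply continuity_ex_RInt, cf.
Qed.

Lemma half_int_lim M f : exp_decay M f ->
  is_lim_seq (fun n => RInt f 0 (INR n)) (half_int f).
Proof.
intros df; assert (M0 := exp_decay_nonneg M f df).
assert (ex : ex_finite_lim_seq (fun n => RInt f 0 (INR n))).
{ apply ex_lim_seq_cauchy_corr; intros eps.
  assert (e0 := cond_pos eps).
  destruct (nfloor_ex (M / eps)) as [n0 [_ hn0]];
    [apply Rmult_le_pos; [lra|apply Rlt_le, Rinv_0_lt_compat; lra]|].
  assert (main : forall n p, (n0 <= n)%nat -> (n <= p)%nat ->
    Rabs (RInt f 0 (INR n) - RInt f 0 (INR p)) < eps).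
  { intros n p hn np; rewrite <- (RInt_Chasles_R f 0 (INR n) (INR p)) by apply df.
    replace (RInt f 0 (INR n) - (RInt f 0 (INR n) + RInt f (INR n) (INR p)))
      with (- RInt f (INR n) (INR p)) by ring.
    rewrite Rabs_Ropp.
    assert (n1 := pos_INR n); assert (np' := le_INR _ _ np); assert (hn' := le_INR _ _ hn).
    assert (t := RInt_tail M f (INR n) (INR p) df ltac:(lra)).
    assert (e1 := exp_neg_le_inv (INR n) n1); assert (e2 := exp_pos (- INR p)).
    assert (h1 : M * exp (- INR n) <= M * / (1 + INR n)) by (apply Rmult_le_compat_l; lra).
    assert (h2 : 0 <= M * exp (- INR p)) by (apply Rmult_le_pos; lra).
    assert (h3 : M * / (1 + INR n) < eps).
    { apply Rmult_lt_reg_r with (1 + INR n); [lra|].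
      rewrite Rmult_assoc, Rinv_l, Rmult_1_r by lra.
      assert (h4 : M / eps * eps = M) by (field; lra).
      assert (M / eps * eps < (INR n0 + 1) * eps) by (apply Rmult_lt_compat_r; lra).
      nra. }
    lra. }
  exists n0; intros n p hn hp; destruct (Nat.le_ge_cases n p) as [np|np].
  - apply main; assumption.
  - rewrite Rabs_minus_sym; apply main; assumption. }
unfold half_int; apply Lim_seq_correct' in ex; exact ex.
Qed.

Lemma lim_abs_sub_le (u : nat -> R) (l c K : R) : is_lim_seq u l ->
  eventually (fun n => Rabs (c - u n) <= K) -> Rabs (c - l) <= K.
Proof.
intros hl he.
assert (hl' : is_lim_seq (fun n => Rabs (c - u n)) (Rabs (c - l))).
{ apply (is_lim_seq_abs _ (c - l)); apply is_lim_seq_minus'; [apply is_lim_seq_const|exact hl]. }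
exact (is_lim_seq_le_loc _ _ _ _ he hl' (is_lim_seq_const K)).
Qed.

Lemma half_int_tail M f b : exp_decay M f -> 0 <= b ->
  Rabs (RInt f 0 b - half_int f) <= M * exp (- b).
Proof.
intros df b0; apply (lim_abs_sub_le _ _ _ _ (half_int_lim M f df)).
destruct (nfloor_ex b b0) as [n0 hn0]; exists (S n0); intros n hn.
rewrite <- (RInt_Chasles_R f 0 b (INR n)) by apply df.
replace (RInt f 0 b - (RInt f 0 b + RInt f b (INR n))) with (- RInt f b (INR n)) by ring.
rewrite Rabs_Ropp.
assert (hn' := le_INR _ _ hn); rewrite S_INR in hn'.
assert (t := RInt_tail M f b (INR n) df ltac:(lra)).
assert (0 <= M * exp (- INR n))
  by (apply Rmult_le_pos; [exact (exp_decay_nonneg M f df)|apply Rlt_le, exp_pos]).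
lra.
Qed.

Lemma half_int_bound M f : exp_decay M f -> Rabs (half_int f) <= M.
Proof.
intros df; assert (h := half_int_tail M f 0 df (Rle_refl 0)).
rewrite RInt_point, Ropp_0, exp_0 in h; change zero with 0 in h.
rewrite Rminus_0_l, Rabs_Ropp in h; lra.
Qed.

Lemma half_int_lin M1 M2 f g c : exp_decay M1 f -> exp_decay M2 g ->
  half_int (fun t => f t + c * g t) = half_int f + c * half_int g.
Proof.
intros df dg.
assert (h := is_lim_seq_plus' _ _ _ _ (half_int_lim _ _ df)
               (is_lim_seq_scal_l _ c _ (half_int_lim _ _ dg))).
unfold half_int at 1.
rewrite (Lim_seq_ext _ (fun n => RInt f 0 (INR n) + c * RInt g 0 (INR n))).
- apply is_lim_seq_unique in h; rewrite h; reflexivity.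
- intros n; rewrite RInt_plus with (g := fun t => c * g t).
  + rewrite (RInt_scal (V := R_CompleteNormedModule) g); [reflexivity|].
    apply continuity_ex_RInt, dg.
  + apply continuity_ex_RInt, df.
  + apply continuity_ex_RInt; apply (continuity_mult (fun _ => c) g);
      [apply continuity_const; red; reflexivity|apply dg].
Qed.

Lemma exp_decay_lin M1 M2 f g c : exp_decay M1 f -> exp_decay M2 g ->
  exp_decay (M1 + Rabs c * M2) (fun t => f t + c * g t).
Proof.
intros [cf df] [cg dg]; split.
- apply (continuity_plus f (fun t => c * g t)); [exact cf|].
  apply (continuity_mult (fun _ => c) g); [apply continuity_const; red; reflexivity|exact cg].
- intros t t0; apply Rle_trans with (1 := Rabs_triang _ _); rewrite Rabs_mult.
  assert (h1 := df t t0).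
  assert (h2 := Rmult_le_compat_l _ _ _ (Rabs_pos c) (dg t t0)); lra.
Qed.

(** The line is folded onto the half-line; the coefficient 1 matches the shape of [half_int_lin]. *)
Definition two_sided (f : R -> R) : R := half_int (fun t => f t + 1 * f (- t)).

Definition exp_decay2 (M : R) (f : R -> R) : Prop :=
  continuity f /\ forall t, Rabs (f t) <= M * exp (- Rabs t).

Lemma exp_decay2_half M f : exp_decay2 M f ->
  exp_decay M f /\ exp_decay M (fun t => f (- t)).
Proof.
intros [cf hf]; split; split.
- exact cf.
- intros t t0; rewrite <- (Rabs_pos_eq t) at 2 by exact t0; apply hf.
- apply (continuity_comp (fun t => - t) f); [|exact cf].
  apply continuity_opp, derivable_continuous, derivable_id.
- intros t t0; assert (g := hf (- t)); rewrite Rabs_Ropp, (Rabs_pos_eq t t0) in g; exact g.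
Qed.

Lemma RInt_reflect f a : continuity f -> RInt f (- a) 0 = RInt (fun t => f (- t)) 0 a.
Proof.
intros cf; symmetry.
assert (I := RInt_correct f 0 (- a) (continuity_ex_RInt f 0 (- a) cf)).
rewrite <- Ropp_0 in I at 1; apply is_RInt_comp_opp in I.
apply is_RInt_opp in I; apply is_RInt_unique in I.
apply eq_trans with (2 := opp_RInt_swap f 0 (- a) (continuity_ex_RInt f 0 (- a) cf)).
apply eq_trans with (2 := I); apply RInt_ext; intros x _; unfold opp; simpl; ring.
Qed.

Lemma improper_two_sided M f : exp_decay2 M f -> improper_int_R f (two_sided f).
Proof.
intros df; destruct (exp_decay2_half M f df) as [d1 d2].
assert (cf : continuity f) by apply df.
split; [intros a b; constructor; apply ex_RInt_Reals_0, continuity_ex_RInt, cf|].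
intros eps e0; assert (M0 := exp_decay_nonneg M f d1).
exists (2 * M / eps); intros a b pr ha hb.
assert (p0 : 0 <= 2 * M / eps) by (apply Rmult_le_pos; [lra|apply Rlt_le, Rinv_0_lt_compat; lra]).
rewrite <- RInt_Reals, <- (RInt_Chasles_R f (- a) 0 b), RInt_reflect by exact cf.
unfold two_sided; rewrite (half_int_lin M M f (fun t => f (- t)) 1 d1 d2).
assert (h1 := half_int_tail M f b d1 ltac:(lra)).
assert (h2 := half_int_tail M _ a d2 ltac:(lra)).
assert (small : forall c, 2 * M / eps < c -> M * exp (- c) < eps / 2).
{ intros c hc; assert (e1 := exp_neg_le_inv c ltac:(lra)).
  apply Rle_lt_trans with (M * / (1 + c)); [apply Rmult_le_compat_l; lra|].
  apply Rmult_lt_reg_r with (1 + c); [lra|]; rewrite Rmult_assoc, Rinv_l, Rmult_1_r by lra.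
  assert (h4 : 2 * M / eps * eps = 2 * M) by (field; lra).
  assert (2 * M / eps * eps < c * eps) by (apply Rmult_lt_compat_r; lra).
  lra. }
assert (s1 := small a ha); assert (s2 := small b hb).
match goal with |- Rabs ?x < _ => replace x with
  ((RInt (fun t => f (- t)) 0 a - half_int (fun t => f (- t))) + (RInt f 0 b - half_int f)) by ring end.
apply Rle_lt_trans with (1 := Rabs_triang _ _); lra.
Qed.

Lemma psum_close u psi h eps n0 : continuity psi -> 0 < h ->
  (forall j t, (1 <= j <= n0)%nat -> h * (INR j - 1) <= t <= h * INR j -> Rabs (psi t - u j) <= eps) ->
  forall n, (n <= n0)%nat -> Rabs (h * psum u n - RInt psi 0 (h * INR n)) <= eps * (h * INR n).
Proof.
intros cp h0 hu; induction n as [|n IH]; intros hn.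
- simpl; rewrite !Rmult_0_r, RInt_point; change zero with 0; rewrite Rminus_diag, Rabs_R0; lra.
- cbn [psum]; rewrite <- (RInt_Chasles_R psi 0 (h * INR n)) by exact cp.
  assert (e : RInt psi (h * INR n) (h * INR (S n)) - h * u (S n) =
    RInt (fun t => psi t - u (S n)) (h * INR n) (h * INR (S n))).
  { rewrite (RInt_minus (V := R_CompleteNormedModule) psi (fun _ => u (S n)));
      [|apply continuity_ex_RInt, cp|apply ex_RInt_const].
    rewrite RInt_const.
    change (RInt psi (h * INR n) (h * INR (S n)) - h * u (S n) =
      RInt psi (h * INR n) (h * INR (S n)) - (h * INR (S n) - h * INR n) * u (S n)).
    rewrite S_INR; ring. }
  assert (b : Rabs (RInt (fun t => psi t - u (S n)) (h * INR n) (h * INR (S n))) <=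
     (h * INR (S n) - h * INR n) * eps).
  { apply abs_RInt_le_const.
    - rewrite S_INR; lra.
    - apply continuity_ex_RInt, (continuity_minus psi (fun _ => u (S n)));
        [exact cp|apply continuity_const; red; reflexivity].
    - intros t ht; apply hu; [lia|]; replace (INR (S n) - 1) with (INR n) by (rewrite S_INR; ring).
      exact ht. }
  rewrite <- e in b; specialize (IH ltac:(lia)).
  replace (h * (psum u n + u (S n)) - (RInt psi 0 (h * INR n) + RInt psi (h * INR n) (h * INR (S n))))
    with ((h * psum u n - RInt psi 0 (h * INR n)) +
          - (RInt psi (h * INR n) (h * INR (S n)) - h * u (S n))) by ring.
  apply Rle_trans with (1 := Rabs_triang _ _); rewrite Rabs_Ropp.
  rewrite S_INR in *; lra.
Qed.

(** Discrete counterpart of [RInt_tail]: 1 + h <= exp h gives h exp (- h (n + 1)) <= exp (- h n) -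
    exp (- h (n + 1)), which telescopes. *)
Lemma psum_tail u h M n0 N : 0 < h -> 0 <= M ->
  (forall j, (j <= N)%nat -> Rabs (u j) <= M * exp (- (h * INR j))) ->
  forall n, (n0 <= n)%nat -> (n <= N)%nat ->
  Rabs (h * psum u n - h * psum u n0) <= M * exp (- (h * INR n0)) - M * exp (- (h * INR n)).
Proof.
intros h0 M0 hu; induction 1 as [|n n0n IH]; intros hn.
- rewrite !Rminus_diag, Rabs_R0; lra.
- cbn [psum]; specialize (IH ltac:(lia)); assert (b := hu (S n) hn).
  replace (h * (psum u n + u (S n)) - h * psum u n0)
    with ((h * psum u n - h * psum u n0) + h * u (S n)) by ring.
  apply Rle_trans with (1 := Rabs_triang _ _).
  rewrite Rabs_mult, (Rabs_pos_eq h) by lra.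
  assert (e : exp (- (h * INR n)) = exp (- (h * INR (S n))) * exp h)
    by (rewrite <- exp_plus; f_equal; rewrite S_INR; ring).
  assert (g := exp_ineq1_le h); assert (p := exp_pos (- (h * INR (S n)))).
  assert (h1 : h * Rabs (u (S n)) <= h * (M * exp (- (h * INR (S n)))))
    by (apply Rmult_le_compat_l; lra).
  assert (h2 : M * exp (- (h * INR (S n))) * (1 + h) <= M * exp (- (h * INR (S n))) * exp h)
    by (apply Rmult_le_compat_l; [apply Rmult_le_pos; lra|lra]).
  rewrite e in IH; lra.
Qed.

(** A dominated convergence argument: the sum and the integral are cut near B, with tails controlled
    by M exp (- t), and compared on [0, B] by uniform continuity. *)
Lemma riemann_limit (psi : R -> R) (u : nat -> nat -> R) (h : nat -> R) (M : R) :
  exp_decay M psi -> (forall N, 0 < h N) ->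
  (forall eps, 0 < eps -> exists N0, forall N, (N0 <= N)%nat -> h N < eps) ->
  (forall B, exists N0, forall N, (N0 <= N)%nat -> B <= h N * INR N) ->
  (forall N j, (j <= N)%nat -> Rabs (u N j) <= M * exp (- (h N * INR j))) ->
  (forall B eps, 0 < B -> 0 < eps -> exists N0, forall N j, (N0 <= N)%nat -> (j <= N)%nat ->
     h N * INR j <= B -> Rabs (u N j - psi (h N * INR j)) <= eps) ->
  is_lim_seq (fun N => h N * psum (u N) N) (half_int psi).
Proof.
intros dp hpos hsmall hlarge hdom hclose.
assert (M0 := exp_decay_nonneg _ _ dp); assert (cp : continuity psi) by apply dp.
apply is_lim_seq_Reals; intros eps e0.
(* The cut h n0 lies in (B - 1, B], so each tail is at most M / B <= eps / 4; with e = eps / (8 B)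
   the compact part also costs at most eps / 4. *)
set (B := 1 + 4 * M / eps).
assert (B1 : 1 <= B).
{ unfold B; assert (0 <= 4 * M / eps) by (apply Rmult_le_pos; [lra|apply Rlt_le, Rinv_0_lt_compat; lra]); lra. }
assert (MB : 4 * M = (B - 1) * eps) by (unfold B; field; lra).
set (e := eps / (8 * B)); assert (epos : 0 < e) by (apply Rdiv_lt_0_compat; lra).
destruct (Heine psi (fun t => 0 <= t <= B) (compact_P3 0 B) (fun x _ => cp x) (mkposreal e epos))
  as [[del del0] hdel]; simpl in hdel.
destruct (hsmall (Rmin del 1) ltac:(apply Rmin_pos; lra)) as [N1 hN1].
destruct (hlarge B) as [N2 hN2].
destruct (hclose B e ltac:(lra) epos) as [N3 hN3].
exists (N1 + N2 + N3)%nat; intros N hN.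
specialize (hN1 N ltac:(lia)); specialize (hN2 N ltac:(lia)).
assert (h0 := hpos N); set (hh := h N) in *.
assert (hd : hh < del) by (assert (t := Rmin_l del 1); lra).
assert (h1 : hh < 1) by (assert (t := Rmin_r del 1); lra).
destruct (nfloor_ex (B / hh)) as [n0 [n0B Bn0]]; [apply Rlt_le, Rdiv_lt_0_compat; lra|].
assert (hB : B / hh * hh = B) by (field; lra).
assert (a1 : hh * INR n0 <= B) by (rewrite <- hB, Rmult_comm; apply Rmult_le_compat_r; lra).
assert (a2 : B - 1 < hh * INR n0).
{ assert (B / hh * hh < (INR n0 + 1) * hh) by (apply Rmult_lt_compat_r; lra); lra. }
assert (n0N : (n0 <= N)%nat).
{ apply INR_le; apply Rmult_le_reg_l with hh; lra. }
assert (P1 := psum_close (u N) psi hh (2 * e) n0 cp h0).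
assert (P1' : Rabs (hh * psum (u N) n0 - RInt psi 0 (hh * INR n0)) <= 2 * e * (hh * INR n0)).
{ apply P1; [|lia]; intros j t hj ht.
  assert (j1 : 1 <= INR j) by (apply (le_INR 1); lia).
  assert (jn : INR j <= INR n0) by (apply le_INR; lia).
  assert (hjB : hh * INR j <= B) by (apply Rle_trans with (2 := a1); apply Rmult_le_compat_l; lra).
  assert (c1 := hN3 N j ltac:(lia) ltac:(lia) hjB); fold hh in c1.
  assert (c2 : Rabs (psi t - psi (hh * INR j)) < e).
  { apply hdel.
    - split; [|lra]; apply Rle_trans with (2 := proj1 ht); apply Rmult_le_pos; lra.
    - split; [apply Rmult_le_pos; lra|lra].
    - rewrite Rabs_minus_sym, Rabs_pos_eq; lra. }
  replace (psi t - u N j) with ((psi t - psi (hh * INR j)) + - (u N j - psi (hh * INR j))) by ring.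
  apply Rle_trans with (1 := Rabs_triang _ _); rewrite Rabs_Ropp; lra. }
assert (P2 := psum_tail (u N) hh M n0 N h0 M0 (hdom N) N n0N (Nat.le_refl N)).
assert (P3 := half_int_tail M psi (hh * INR n0) dp ltac:(lra)).
assert (E1 := exp_neg_le_inv (hh * INR n0) ltac:(lra)).
assert (E2 : M * exp (- (hh * INR n0)) <= eps / 4).
{ apply Rle_trans with (M * / B).
  - apply Rmult_le_compat_l; [lra|]; apply Rle_trans with (1 := E1); apply Rinv_le_contravar; lra.
  - apply Rmult_le_reg_r with B; [lra|]; rewrite Rmult_assoc, Rinv_l by lra; nra. }
assert (E3 : 0 <= M * exp (- (hh * INR N))) by (apply Rmult_le_pos; [lra|apply Rlt_le, exp_pos]).
assert (E4 : 2 * e * (hh * INR n0) <= eps / 4).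
{ apply Rle_trans with (2 * e * B); [apply Rmult_le_compat_l; lra|].
  unfold e; right; field; lra. }
unfold R_dist, Rdist.
replace (hh * psum (u N) N - half_int psi) with
  ((hh * psum (u N) N - hh * psum (u N) n0) +
   ((hh * psum (u N) n0 - RInt psi 0 (hh * INR n0)) + (RInt psi 0 (hh * INR n0) - half_int psi))) by ring.
apply Rle_lt_trans with (1 := Rabs_triang _ _).
assert (T := Rabs_triang (hh * psum (u N) n0 - RInt psi 0 (hh * INR n0)) (RInt psi 0 (hh * INR n0) - half_int psi)).
lra.
Qed.

(** * The Fourier integral *)

Lemma cont_mul f g : continuity f -> continuity g -> continuity (fun t => f t * g t).
Proof. apply continuity_mult. Qed.
Lemma cont_add f g : continuity f -> continuity g -> continuity (fun t => f t + g t).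
Proof. apply continuity_plus. Qed.
Lemma cont_sub f g : continuity f -> continuity g -> continuity (fun t => f t - g t).
Proof. apply continuity_minus. Qed.
Lemma cont_opp f : continuity f -> continuity (fun t => - f t).
Proof. apply continuity_opp. Qed.
Lemma cont_const c : continuity (fun _ => c).
Proof. apply continuity_const; red; reflexivity. Qed.
Lemma cont_id : continuity (fun t => t).
Proof. apply derivable_continuous, derivable_id. Qed.
Lemma cont_exp f : continuity f -> continuity (fun t => exp (f t)).
Proof. intros cf; apply (continuity_comp f exp cf), derivable_continuous, derivable_exp. Qed.
Lemma cont_cos f : continuity f -> continuity (fun t => cos (f t)).
Proof. intros cf; apply (continuity_comp f cos cf), derivable_continuous, derivable_cos. Qed.
Lemma cont_sin f : continuity f -> continuity (fun t => sin (f t)).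
Proof. intros cf; apply (continuity_comp f sin cf), derivable_continuous, derivable_sin. Qed.
Lemma cont_cosh f : continuity f -> continuity (fun t => cosh (f t)).
Proof. intros cf; apply (continuity_comp f cosh cf), derivable_continuous, derivable_cosh. Qed.
Lemma cont_sinh f : continuity f -> continuity (fun t => sinh (f t)).
Proof. intros cf; apply (continuity_comp f sinh cf), derivable_continuous, derivable_sinh. Qed.

Ltac cont := repeat first
  [ assumption | apply cont_const | apply cont_id | apply cont_mul | apply cont_add
  | apply cont_sub | apply cont_opp | apply cont_exp | apply cont_cos | apply cont_sin
  | apply cont_cosh | apply cont_sinh ].

Lemma exp_le_mono u v : u <= v -> exp u <= exp v.
Proof. intros [h|h]; [left; apply exp_increasing, h|right; rewrite h; reflexivity]. Qed.

Lemma exp_neg_sub u v : 0 <= u <= v -> exp (- u) - exp (- v) <= v - u.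
Proof.
intros uv; replace (- v) with (- u + - (v - u)) by ring; rewrite exp_plus.
assert (h := exp_ineq1_le (- (v - u))).
assert (h1 : exp (- u) <= 1) by (rewrite <- exp_0; apply exp_le_mono; lra).
assert (h0 := exp_pos (- u)).
assert (exp (- u) * (1 + - (v - u)) <= exp (- u) * exp (- (v - u))) by (apply Rmult_le_compat_l; lra).
nra.
Qed.

(** Completing the square in - k t^2 + (Y + 1) t; the extra k pays for t^2 - 1 <= t^(2 m). *)
Definition decay_const (k Y : R) : R := exp (k + (Y + 1) ^ 2 / (4 * k)).

(** Stated for an arbitrary v above the leading term, so that one constant dominates q and all its
    approximants. *)
Lemma main_term_decay k m Y t v : 0 < k -> (1 <= m)%nat -> 0 <= t -> k * t ^ (2 * m) <= v ->
  exp (- v) * exp (Y * t) <= decay_const k Y * exp (- t).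
Proof.
intros k0 m1 t0 hv; unfold decay_const; rewrite <- !exp_plus; apply exp_le_mono.
assert (h : t ^ 2 - 1 <= t ^ (2 * m)).
{ destruct (Rle_dec 1 t) as [t1|t1].
  - assert (t ^ 2 <= t ^ (2 * m)) by (apply Rle_pow; [lra|lia]); lra.
  - assert (0 <= t ^ (2 * m)) by (apply pow_le; lra); nra. }
assert (h' : k * (t ^ 2 - 1) <= k * t ^ (2 * m)) by (apply Rmult_le_compat_l; lra).
assert (sq : 0 <= k * (t - (Y + 1) / (2 * k)) ^ 2) by (apply Rmult_le_pos; [lra|apply pow2_ge_0]).
replace (k * (t - (Y + 1) / (2 * k)) ^ 2)
  with (k * t ^ 2 - (Y + 1) * t + (Y + 1) ^ 2 / (4 * k)) in sq by (field; lra).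
lra.
Qed.

Lemma qpol_even k m gs t : qpol k m gs (- t) = qpol k m gs t.
Proof.
unfold qpol; rewrite !pow_mult; replace ((- t) ^ 2) with (t ^ 2) by ring; reflexivity.
Qed.

Lemma exp_sub_one_bound u : Rabs (exp u - 1) <= Rabs u * exp (Rabs u).
Proof.
assert (h := exp_ineq1_le u); assert (h' := exp_ineq1_le (- u)).
assert (e : exp u * exp (- u) = 1) by (rewrite <- exp_plus, Rplus_opp_r, exp_0; reflexivity).
assert (p := exp_pos u); assert (p' := exp_pos (- u)).
unfold Rabs at 2 3; destruct (Rcase_abs u) as [u0|u0]; apply Rabs_le; split; nra.
Qed.

Lemma exp_taylor_bound u : Rabs (exp u - 1 - u) <= u ^ 2 * exp (Rabs u).
Proof.
assert (h := exp_ineq1_le u); rewrite Rabs_pos_eq by lra.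
assert (h' := exp_ineq1_le (- u)).
assert (e : exp u * exp (- u) = 1) by (rewrite <- exp_plus, Rplus_opp_r, exp_0; reflexivity).
assert (p := exp_pos u); assert (p' := exp_pos (- u)).
assert (h1 : exp u - 1 <= u * exp u) by nra.
unfold Rabs; destruct (Rcase_abs u) as [u0|u0].
- assert (exp u - 1 - u <= u * (exp u - 1)) by nra.
  assert (u * (exp u - 1) <= u ^ 2) by nra.
  assert (1 <= exp (- u)) by lra.
  assert (0 <= u ^ 2) by nra; nra.
- assert (exp u - 1 - u <= u * (exp u - 1)) by nra.
  assert (u * (exp u - 1) <= u * (u * exp u)) by (apply Rmult_le_compat_l; lra).
  nra.
Qed.

Lemma sin_taylor_bound u : Rabs (sin u - u) <= u ^ 2.
Proof.
assert (main : forall t, 0 < t -> Rabs (sin t - t) <= t ^ 2).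
{ intros t t0.
  destruct (MVT_cor2 (fun x => sin x - x) (fun x => cos x - 1) 0 t t0) as [c [e hc]].
  - intros c _; apply is_derive_Reals; auto_derive; [trivial|ring].
  - rewrite sin_0 in e; replace (sin t - t) with ((cos c - 1) * t) by lra.
    assert (b := cos_lower c); assert (b' := COS_bound c).
    rewrite Rabs_mult, (Rabs_pos_eq t), Rabs_minus_sym, Rabs_pos_eq by lra.
    assert (1 - cos c <= c) by (destruct (Rle_dec c 2); nra).
    simpl; rewrite Rmult_1_r; apply Rmult_le_compat_r; lra. }
destruct (Rtotal_order u 0) as [u0|[->|u0]].
- assert (h := main (- u) ltac:(lra)); rewrite sin_neg in h.
  replace (- sin u - - u) with (- (sin u - u)) in h by ring; rewrite Rabs_Ropp in h.
  replace ((- u) ^ 2) with (u ^ 2) in h by ring; exact h.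
- rewrite sin_0, Rminus_diag, Rabs_R0; lra.
- apply main, u0.
Qed.

Lemma sqr_le_exp t : 0 <= t -> t ^ 2 <= 4 * exp t.
Proof.
intros t0; assert (h := exp_ineq1_le (t / 2)).
assert (e : exp t = exp (t / 2) * exp (t / 2)) by (rewrite <- exp_plus; f_equal; field).
rewrite e; nra.
Qed.

(** With c = a + i b, these are the two parts of e^(i c t) - 1 - i c t. *)
Definition expi_err_re (a b t : R) : R := expi_re (a * t) (b * t) - 1 + b * t.
Definition expi_err_im (a b t : R) : R := expi_im (a * t) (b * t) - a * t.

Lemma expi_err_bound a b t : Rabs b <= 1 ->
  Rabs (expi_err_re a b t) <= 8 * (a ^ 2 + b ^ 2) * exp (2 * Rabs t) /\
  Rabs (expi_err_im a b t) <= 8 * (a ^ 2 + b ^ 2) * exp (2 * Rabs t).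
Proof.
intros b1; unfold expi_err_re, expi_err_im, expi_re, expi_im.
set (al := a * t); set (be := b * t).
assert (t0 := Rabs_pos t); assert (b0 := Rabs_pos b).
assert (E1 : exp (Rabs be) <= exp (Rabs t)).
{ apply exp_le_mono; unfold be; rewrite Rabs_mult; nra. }
assert (E2 : Rabs t ^ 2 <= 4 * exp (Rabs t)) by (apply sqr_le_exp, t0).
rewrite <- Rsqr_pow2, <- Rsqr_abs, Rsqr_pow2 in E2.
assert (E0 : 0 < exp (Rabs be)) by apply exp_pos.
assert (Eb : exp (- be) <= exp (Rabs be)) by (apply exp_le_mono; rewrite <- Rabs_Ropp; apply Rle_abs).
assert (Ebp := exp_pos (- be)).
assert (tot : 2 * (al ^ 2 + be ^ 2) * exp (Rabs be) <= 8 * (a ^ 2 + b ^ 2) * exp (2 * Rabs t)).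
{ replace (2 * Rabs t) with (Rabs t + Rabs t) by ring; rewrite exp_plus.
  replace (2 * (al ^ 2 + be ^ 2)) with (2 * (a ^ 2 + b ^ 2) * t ^ 2) by (unfold al, be; ring).
  assert (0 <= a ^ 2 + b ^ 2) by (assert (x := pow2_ge_0 a); assert (y := pow2_ge_0 b); lra).
  assert (0 <= t ^ 2) by apply pow2_ge_0.
  assert (h : t ^ 2 * exp (Rabs be) <= 4 * exp (Rabs t) * exp (Rabs t)) by (apply Rmult_le_compat; lra).
  replace (2 * (a ^ 2 + b ^ 2) * t ^ 2 * exp (Rabs be)) with (2 * (a ^ 2 + b ^ 2) * (t ^ 2 * exp (Rabs be))) by ring.
  replace (8 * (a ^ 2 + b ^ 2) * (exp (Rabs t) * exp (Rabs t))) with (2 * (a ^ 2 + b ^ 2) * (4 * exp (Rabs t) * exp (Rabs t))) by ring.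
  apply Rmult_le_compat_l; lra. }
assert (T1 := exp_taylor_bound (- be)); rewrite Rabs_Ropp in T1.
assert (T2 := exp_sub_one_bound (- be)); rewrite !Rabs_Ropp in T2.
replace ((- be) ^ 2) with (be ^ 2) in T1 by ring.
assert (C1 := cos_lower al); assert (C2 := COS_bound al).
assert (S1 := sin_taylor_bound al).
assert (al2 := pow2_ge_0 al); assert (be2 := pow2_ge_0 be).
split; apply Rle_trans with (2 := tot).
- replace (exp (- be) * cos al - 1 + be)
    with ((exp (- be) - 1 - - be) + - (exp (- be) * (1 - cos al))) by ring.
  apply Rle_trans with (1 := Rabs_triang _ _).
  rewrite Rabs_Ropp, (Rabs_pos_eq (exp (- be) * _)) by (apply Rmult_le_pos; lra).
  assert (exp (- be) * (1 - cos al) <= exp (Rabs be) * (al ^ 2 / 2)) by (apply Rmult_le_compat; lra).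
  nra.
- replace (exp (- be) * sin al - al)
    with (exp (- be) * (sin al - al) + al * (exp (- be) - 1)) by ring.
  apply Rle_trans with (1 := Rabs_triang _ _); rewrite !Rabs_mult, (Rabs_pos_eq (exp (- be))) by lra.
  assert (exp (- be) * Rabs (sin al - al) <= exp (Rabs be) * al ^ 2)
    by (apply Rmult_le_compat; [lra|apply Rabs_pos|lra|lra]).
  assert (Rabs al * Rabs (exp (- be) - 1) <= Rabs al * (Rabs be * exp (Rabs be)))
    by (apply Rmult_le_compat_l; [apply Rabs_pos|lra]).
  assert (2 * (Rabs al * Rabs be) <= al ^ 2 + be ^ 2).
  { rewrite <- (Rsqr_pow2 al), <- (Rsqr_pow2 be), (Rsqr_abs al), (Rsqr_abs be).
    assert (g := pow2_ge_0 (Rabs al - Rabs be)); unfold Rsqr; lra. }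
  nra.
Qed.

(** * Regularity of q inherited from its approximants *)

Section Main.
Variables (k mu : R) (m : nat) (Nb : option nat) (beta : nat -> R) (q : R -> R) (s : R).
Hypotheses (k0 : 0 < k) (mu0 : mu >= 0) (m1 : (1 <= m)%nat).
Hypothesis hb : forall n, in_idx Nb n = true -> beta n <> 0.
Hypothesis hs : Un_cv (beta_sum Nb beta) s.
Hypothesis hq : is_q k mu m Nb beta q.

Let qa (N : nat) : R -> R := apx k mu m Nb beta (S N).

Lemma qa_le_q N t : qa N t <= q t.
Proof. apply apx_le_q; auto; lia. Qed.

Lemma qa_lower N t : k * t ^ (2 * m) <= qa N t.
Proof. apply qpol_lower; lra. Qed.

Lemma main_term_nonneg t : 0 <= k * t ^ (2 * m).
Proof. apply Rmult_le_pos; [lra|rewrite pow_mult; apply pow_le, pow2_ge_0]. Qed.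

Lemma q_lower t : k * t ^ (2 * m) <= q t.
Proof. apply Rle_trans with (1 := qa_lower 0 t), qa_le_q. Qed.

Lemma apx_err_lim B : is_lim_seq (fun N => apx_err mu Nb beta s (S N) B) 0.
Proof.
unfold apx_err.
replace 0 with ((mu * B ^ 2) ^ 2 * 0 + B ^ 2 * (s - s)) by ring.
apply is_lim_seq_plus'.
- unfold Rdiv; apply (is_lim_seq_scal_l (fun N => / INR (S N)) _ 0).
  apply (is_lim_seq_incr_1 (fun N => / INR N)).
  apply (is_lim_seq_inv _ p_infty); [apply is_lim_seq_INR|discriminate].
- apply (is_lim_seq_scal_l (fun N => s - beta_sum Nb beta (S N)) _ (s - s)).
  apply is_lim_seq_minus'; [apply is_lim_seq_const|].
  apply (is_lim_seq_incr_1 (beta_sum Nb beta)), is_lim_seq_Reals, hs.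
Qed.

Lemma q_sub_qa N t : q t - qa N t <= q t * apx_err mu Nb beta s (S N) t.
Proof.
assert (h : q t <= qa N t * exp (apx_err mu Nb beta s (S N) t))
  by (apply q_le_apx; auto; try lra; lia).
set (d := apx_err mu Nb beta s (S N) t) in *.
assert (e := exp_ineq1_le (- d)); assert (p := exp_pos (- d)).
assert (e1 : exp d * exp (- d) = 1) by (rewrite <- exp_plus, Rplus_opp_r, exp_0; reflexivity).
assert (q0 : 0 <= q t) by (assert (x := q_lower t); assert (y := main_term_nonneg t); lra).
assert (h1 : q t * exp (- d) <= qa N t * exp d * exp (- d)) by (apply Rmult_le_compat_r; lra).
rewrite Rmult_assoc, e1, Rmult_1_r in h1.
assert (q t * (1 + - d) <= q t * exp (- d)) by (apply Rmult_le_compat_l; lra).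
lra.
Qed.

Lemma qa_lim t : is_lim_seq (fun N => qa N t) (q t).
Proof.
apply (is_lim_seq_le_le (fun N => q t - q t * apx_err mu Nb beta s (S N) t) _ (fun _ => q t)).
- intros N; assert (h := q_sub_qa N t); assert (h' := qa_le_q N t); lra.
- replace (Finite (q t)) with (Finite (q t - q t * 0)) by (f_equal; ring).
  apply is_lim_seq_minus'; [apply is_lim_seq_const|].
  apply (is_lim_seq_scal_l _ (q t) 0), apx_err_lim.
- apply is_lim_seq_const.
Qed.

Lemma q_even t : q (- t) = q t.
Proof.
assert (h1 := qa_lim (- t)); assert (h2 := qa_lim t).
apply (is_lim_seq_ext _ (fun N => qa N t)) in h1; [|intros; apply qpol_even].
apply is_lim_seq_unique in h1; apply is_lim_seq_unique in h2.
rewrite h1 in h2; injection h2; auto.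
Qed.

Lemma q_convex_incr : convex_incr q.
Proof.
intros a t d st d0.
assert (C : forall N, 0 <= qa N a <= qa N t /\ d * (qa N t - qa N a) <= (t - a) * (qa N (t + d) - qa N t))
  by (intros N; apply (convex_incr_qpol k m (apx_list mu Nb beta (S N)) (Rlt_le _ _ k0)); assumption).
assert (le : forall u v l1 l2, (forall n, u n <= v n) -> is_lim_seq u (Finite l1) -> is_lim_seq v (Finite l2) -> l1 <= l2)
  by (intros u v l1 l2 h; exact (is_lim_seq_le u v l1 l2 h)).
split; [split|].
- apply (le (fun _ => 0) (fun N => qa N a)); [intros; apply C|apply is_lim_seq_const|apply qa_lim].
- apply (le (fun N => qa N a) (fun N => qa N t)); [intros; apply C|apply qa_lim|apply qa_lim].
- apply (le (fun N => d * (qa N t - qa N a)) (fun N => (t - a) * (qa N (t + d) - qa N t))); [intros; apply C| |].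
  + apply (is_lim_seq_scal_l _ d (q t - q a)), is_lim_seq_minus'; apply qa_lim.
  + apply (is_lim_seq_scal_l _ (t - a) (q (t + d) - q t)), is_lim_seq_minus'; apply qa_lim.
Qed.

Lemma q_mono a t : 0 <= a <= t -> 0 <= q a <= q t.
Proof. intros h; apply (q_convex_incr a t 1 h Rlt_0_1). Qed.

(** By convexity the slope on [a, t] is at most that on [t, t + 1]. The constant g(B + 1) is bounded
    by q(B + 1) for every approximant, which makes the estimate uniform in N. *)
Lemma convex_incr_lip g a t B : convex_incr g -> 0 <= a <= t -> t <= B ->
  g t - g a <= (t - a) * g (B + 1).
Proof.
intros cg h tB.
destruct (cg a t 1 h Rlt_0_1) as [[g0 g1] g2]; destruct (cg (t + 1) (B + 1) 1 ltac:(lra) Rlt_0_1) as [[_ g3] _].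
assert ((t - a) * (g (t + 1) - g t) <= (t - a) * g (B + 1)) by (apply Rmult_le_compat_l; lra).
lra.
Qed.

Lemma q_abs t : q (Rabs t) = q t.
Proof. unfold Rabs; destruct (Rcase_abs t); [apply q_even|reflexivity]. Qed.

Lemma continuity_q : continuity q.
Proof.
intros x eps e0.
set (L := q (Rabs x + 2)).
assert (L0 : 0 <= L) by (assert (h := Rabs_pos x); apply (q_mono (Rabs x + 2) (Rabs x + 2)); lra).
exists (Rmin 1 (eps / (L + 1))); split; [apply Rmin_pos; [lra|apply Rdiv_lt_0_compat; lra]|].
intros t [_ ht]; simpl in *; unfold R_dist, Rdist in *.
assert (t1 := Rlt_le_trans _ _ _ ht (Rmin_l _ _)); assert (t2 := Rlt_le_trans _ _ _ ht (Rmin_r _ _)).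
assert (T := Rabs_triang_inv t x); assert (T' := Rabs_triang_inv x t).
rewrite (Rabs_minus_sym x t) in T'.
assert (x0 := Rabs_pos x); assert (tt := Rabs_pos t).
assert (lip : Rabs (q t - q x) <= Rabs (t - x) * L).
{ rewrite <- (q_abs t), <- (q_abs x); unfold L.
  replace (Rabs x + 2) with ((Rabs x + 1) + 1) by ring.
  assert (Lp : 0 <= q (Rabs x + 1 + 1)) by (apply (q_mono (Rabs x + 1 + 1) (Rabs x + 1 + 1)); lra).
  destruct (Rle_dec (Rabs x) (Rabs t)) as [c|c].
  - assert (l := convex_incr_lip q (Rabs x) (Rabs t) (Rabs x + 1) q_convex_incr ltac:(lra) ltac:(lra)).
    assert (i := q_mono (Rabs x) (Rabs t) ltac:(lra)).
    rewrite Rabs_pos_eq by lra; apply Rle_trans with (1 := l); apply Rmult_le_compat_r; lra.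
  - assert (l := convex_incr_lip q (Rabs t) (Rabs x) (Rabs x + 1) q_convex_incr ltac:(lra) ltac:(lra)).
    assert (i := q_mono (Rabs t) (Rabs x) ltac:(lra)).
    rewrite Rabs_minus_sym, Rabs_pos_eq by lra; apply Rle_trans with (1 := l); apply Rmult_le_compat_r; lra. }
apply Rle_lt_trans with (1 := lip).
assert (E : eps / (L + 1) * (L + 1) = eps) by (field; lra).
assert (Rabs (t - x) * (L + 1) < eps / (L + 1) * (L + 1)) by (apply Rmult_lt_compat_r; lra).
assert (0 <= Rabs (t - x)) by apply Rabs_pos.
lra.
Qed.

Lemma q_decay Y t : 0 <= Y -> exp (- q t) * exp (Y * Rabs t) <= decay_const k Y * exp (- Rabs t).
Proof.
intros Y0; rewrite <- (q_abs t); apply (main_term_decay k m); auto; [apply Rabs_pos|apply q_lower].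
Qed.

(** * The kernel and the entire function G *)

Definition kern_re (x y t : R) : R := exp (- q t - y * t) * cos (x * t).
Definition kern_im (x y t : R) : R := exp (- q t - y * t) * sin (x * t).

Lemma exp_kern_bound y t : exp (- q t - y * t) <= exp (- q t) * exp (Rabs y * Rabs t).
Proof.
unfold Rminus; rewrite exp_plus; apply Rmult_le_compat_l; [apply Rlt_le, exp_pos|].
apply exp_le_mono; rewrite <- Rabs_mult, <- Rabs_Ropp; apply Rle_abs.
Qed.

Lemma kern_bound x y t :
  Rabs (kern_re x y t) <= exp (- q t) * exp (Rabs y * Rabs t) /\
  Rabs (kern_im x y t) <= exp (- q t) * exp (Rabs y * Rabs t).
Proof.
assert (h := exp_kern_bound y t); assert (p := exp_pos (- q t - y * t)).
unfold kern_re, kern_im; rewrite !Rabs_mult, (Rabs_pos_eq (exp _)) by lra.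
assert (c : Rabs (cos (x * t)) <= 1) by (apply Rabs_le, COS_bound).
assert (c' : Rabs (sin (x * t)) <= 1) by (apply Rabs_le, SIN_bound).
assert (c0 := Rabs_pos (cos (x * t))); assert (c0' := Rabs_pos (sin (x * t))).
split; nra.
Qed.

Lemma abs_le_exp t : Rabs t <= exp (Rabs t).
Proof. assert (h := exp_ineq1_le (Rabs t)); lra. Qed.

Lemma exp_decay2_poly (f : R -> R) Y C : continuity f -> 0 <= Y -> 0 <= C ->
  (forall t, Rabs (f t) <= C * (exp (- q t) * exp (Y * Rabs t))) ->
  exp_decay2 (C * decay_const k Y) f.
Proof.
intros cf Y0 C0 hf; split; [exact cf|]; intros t; apply Rle_trans with (1 := hf t).
rewrite Rmult_assoc; apply Rmult_le_compat_l; [exact C0|apply q_decay, Y0].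
Qed.

Lemma continuity_kern x y : continuity (kern_re x y) /\ continuity (kern_im x y).
Proof.
assert (cq := continuity_q); unfold kern_re, kern_im; split; cont.
Qed.

Lemma kern_decay x y :
  exp_decay2 (1 * decay_const k (Rabs y)) (kern_re x y) /\
  exp_decay2 (1 * decay_const k (Rabs y)) (kern_im x y).
Proof.
destruct (continuity_kern x y) as [c1 c2].
split; apply exp_decay2_poly; auto; try apply Rabs_pos; try lra;
  intros t; rewrite Rmult_1_l; apply kern_bound.
Qed.

Lemma tkern_decay x y :
  exp_decay2 (1 * decay_const k (Rabs y + 1)) (fun t => t * kern_re x y t) /\
  exp_decay2 (1 * decay_const k (Rabs y + 1)) (fun t => t * kern_im x y t).
Proof.
destruct (continuity_kern x y) as [c1 c2].
assert (y0 := Rabs_pos y).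
split; (apply exp_decay2_poly; [cont|lra|lra|]); intros t; rewrite Rmult_1_l, Rabs_mult;
  replace ((Rabs y + 1) * Rabs t) with (Rabs t + Rabs y * Rabs t) by ring; rewrite exp_plus;
  destruct (kern_bound x y t) as [h1 h2]; assert (h := abs_le_exp t);
  replace (exp (- q t) * (exp (Rabs t) * exp (Rabs y * Rabs t)))
    with (exp (Rabs t) * (exp (- q t) * exp (Rabs y * Rabs t))) by ring;
  apply Rmult_le_compat; auto; apply Rabs_pos.
Qed.

Definition G (z : Cx) : Cx :=
  (two_sided (kern_re (fst z) (snd z)), two_sided (kern_im (fst z) (snd z))).

Lemma G_fourier z : fourier_integral q z (G z).
Proof.
destruct (kern_decay (fst z) (snd z)) as [d1 d2].
split; [apply (improper_two_sided _ _ d1)|apply (improper_two_sided _ _ d2)].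
Qed.


Lemma two_sided_lin M1 M2 f g c : exp_decay2 M1 f -> exp_decay2 M2 g ->
  two_sided (fun t => f t + c * g t) = two_sided f + c * two_sided g.
Proof.
intros df dg.
destruct (exp_decay2_half _ _ df) as [f1 f2]; destruct (exp_decay2_half _ _ dg) as [g1 g2].
unfold two_sided; rewrite (half_int_lin _ _ _ _ 1 f1 f2), (half_int_lin _ _ _ _ 1 g1 g2).
rewrite (half_int_lin _ _ _ _ 1 (exp_decay_lin _ _ _ _ c f1 g1) (exp_decay_lin _ _ _ _ c f2 g2)).
rewrite (half_int_lin _ _ _ _ c f1 g1), (half_int_lin _ _ _ _ c f2 g2); ring.
Qed.

Lemma exp_decay2_lin M1 M2 f g c : exp_decay2 M1 f -> exp_decay2 M2 g ->
  exp_decay2 (M1 + Rabs c * M2) (fun t => f t + c * g t).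
Proof.
intros [cf df] [cg dg]; split; [cont|].
intros t; apply Rle_trans with (1 := Rabs_triang _ _); rewrite Rabs_mult.
assert (h1 := df t); assert (h2 := Rmult_le_compat_l _ _ _ (Rabs_pos c) (dg t)); lra.
Qed.

Lemma two_sided_bound M f : exp_decay2 M f -> Rabs (two_sided f) <= 2 * M.
Proof.
intros df; destruct (exp_decay2_half _ _ df) as [f1 f2].
unfold two_sided; rewrite (half_int_lin _ _ _ _ 1 f1 f2).
apply Rle_trans with (1 := Rabs_triang _ _); rewrite Rmult_1_l.
assert (h1 := half_int_bound _ _ f1); assert (h2 := half_int_bound _ _ f2); lra.
Qed.

Lemma two_sided_comb f g u v a b Mf Mg Mu Mv K :
  exp_decay2 Mf f -> exp_decay2 Mg g -> exp_decay2 Mu u -> exp_decay2 Mv v ->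
  exp_decay2 K (fun t => ((f t + (-1) * g t) + a * u t) + b * v t) ->
  Rabs (two_sided f - two_sided g + a * two_sided u + b * two_sided v) <= 2 * K.
Proof.
intros df dg du dv dk.
assert (d1 := exp_decay2_lin _ _ _ _ (-1) df dg); assert (d2 := exp_decay2_lin _ _ _ _ a d1 du).
assert (h := two_sided_bound _ _ dk).
rewrite (two_sided_lin _ _ _ _ b d2 dv) in h.
rewrite (two_sided_lin _ _ _ _ a d1 du) in h.
rewrite (two_sided_lin _ _ _ _ (-1) df dg) in h.
replace (two_sided f - two_sided g + a * two_sided u + b * two_sided v) with
  (two_sided f + -1 * two_sided g + a * two_sided u + b * two_sided v) by ring.
exact h.
Qed.

Lemma kern_plus_re x y a b t : kern_re (x + a) (y + b) t =
  kern_re x y t * expi_re (a * t) (b * t) - kern_im x y t * expi_im (a * t) (b * t).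
Proof.
unfold kern_re, kern_im, expi_re, expi_im.
replace (- q t - (y + b) * t) with ((- q t - y * t) + - (b * t)) by ring.
rewrite exp_plus, Rmult_plus_distr_r, cos_plus; ring.
Qed.

Lemma kern_plus_im x y a b t : kern_im (x + a) (y + b) t =
  kern_re x y t * expi_im (a * t) (b * t) + kern_im x y t * expi_re (a * t) (b * t).
Proof.
unfold kern_re, kern_im, expi_re, expi_im.
replace (- q t - (y + b) * t) with ((- q t - y * t) + - (b * t)) by ring.
rewrite exp_plus, Rmult_plus_distr_r, sin_plus; ring.
Qed.

(** The 16 comes from two remainder terms with constant 8, and the shift by 2 absorbs their exp (2
    |t|). *)
Definition deriv_const (y : R) : R := 16 * decay_const k (Rabs y + 2).

Lemma kern_err x y a b : Rabs b <= 1 ->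
  exp_decay2 ((a ^ 2 + b ^ 2) * deriv_const y)
    (fun t => kern_re (x + a) (y + b) t + -1 * kern_re x y t
              + a * (t * kern_im x y t) + b * (t * kern_re x y t)) /\
  exp_decay2 ((a ^ 2 + b ^ 2) * deriv_const y)
    (fun t => kern_im (x + a) (y + b) t + -1 * kern_im x y t
              + - a * (t * kern_re x y t) + b * (t * kern_im x y t)).
Proof.
intros b1; destruct (continuity_kern x y) as [c1 c2].
destruct (continuity_kern (x + a) (y + b)) as [c3 c4].
assert (y0 := Rabs_pos y).
assert (ab : 0 <= a ^ 2 + b ^ 2) by (assert (u := pow2_ge_0 a); assert (v := pow2_ge_0 b); lra).
assert (key : forall t e1 e2, Rabs e1 <= 8 * (a ^ 2 + b ^ 2) * exp (2 * Rabs t) ->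
  Rabs e2 <= 8 * (a ^ 2 + b ^ 2) * exp (2 * Rabs t) ->
  Rabs (kern_re x y t * e1 + kern_im x y t * e2) <=
  (16 * (a ^ 2 + b ^ 2)) * (exp (- q t) * exp ((Rabs y + 2) * Rabs t))).
{ intros t e1 e2 h1 h2; destruct (kern_bound x y t) as [g1 g2].
  apply Rle_trans with (1 := Rabs_triang _ _); rewrite !Rabs_mult.
  assert (p1 := Rmult_le_compat _ _ _ _ (Rabs_pos _) (Rabs_pos _) g1 h1).
  assert (p2 := Rmult_le_compat _ _ _ _ (Rabs_pos _) (Rabs_pos _) g2 h2).
  rewrite (Rmult_plus_distr_r (Rabs y) 2), exp_plus; lra. }
replace ((a ^ 2 + b ^ 2) * deriv_const y)
  with ((16 * (a ^ 2 + b ^ 2)) * decay_const k (Rabs y + 2)) by (unfold deriv_const; ring).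
split; (apply exp_decay2_poly; [cont|lra|lra|]); intros t;
  destruct (expi_err_bound a b t b1) as [h1 h2].
- rewrite kern_plus_re.
  replace (_ + b * (t * kern_re x y t)) with
    (kern_re x y t * expi_err_re a b t + kern_im x y t * - expi_err_im a b t)
    by (unfold expi_err_re, expi_err_im; ring).
  apply key; [exact h1|rewrite Rabs_Ropp; exact h2].
- rewrite kern_plus_im.
  replace (_ + b * (t * kern_im x y t)) with
    (kern_re x y t * expi_err_im a b t + kern_im x y t * expi_err_re a b t)
    by (unfold expi_err_re, expi_err_im; ring).
  apply key; assumption.
Qed.

Lemma Cnorm_le_abs u v : Cnorm (u, v) <= Rabs u + Rabs v.
Proof.
unfold Cnorm; simpl fst; simpl snd.
assert (hu := Rabs_pos u); assert (hv := Rabs_pos v).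
rewrite <- (sqrt_pow2 (Rabs u + Rabs v)) by lra; apply sqrt_le_1_alt.
rewrite <- (Rsqr_pow2 u), <- (Rsqr_pow2 v), (Rsqr_abs u), (Rsqr_abs v); unfold Rsqr; nra.
Qed.

Lemma Cnorm_sqr z : Cnorm z ^ 2 = fst z ^ 2 + snd z ^ 2.
Proof.
unfold Cnorm; apply pow2_sqrt.
assert (u := pow2_ge_0 (fst z)); assert (v := pow2_ge_0 (snd z)); lra.
Qed.

Lemma G_entire : entire G.
Proof.
intros [x y].
set (Tr := two_sided (fun t => t * kern_re x y t)).
set (Ti := two_sided (fun t => t * kern_im x y t)).
(* The derivative is the integral of i t e^(-q(t)) e^(i z t). *)
exists (- Ti, Tr); intros eps e0.
set (K := deriv_const y).
assert (K0 : 0 < K) by (unfold K, deriv_const, decay_const; assert (h := exp_pos (k + (Rabs y + 2 + 1) ^ 2 / (4 * k))); lra).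
(* Each of the two parts of the remainder is at most 2 K n^2 with n = |a + i b|; the bound 1 ensures
   |b| <= 1 for [kern_err]. *)
exists (Rmin 1 (eps / (4 * K))); split; [apply Rmin_pos; [lra|apply Rdiv_lt_0_compat; lra]|].
intros [a b] [n0 nd].
assert (d1 := Rlt_le_trans _ _ _ nd (Rmin_l _ _)); assert (d2 := Rlt_le_trans _ _ _ nd (Rmin_r _ _)).
assert (N2 := Cnorm_sqr (a, b)); simpl fst in N2; simpl snd in N2; set (n := Cnorm (a, b)) in *.
assert (b1 : Rabs b <= 1).
{ assert (u := pow2_ge_0 a); apply Rabs_le; nra. }
destruct (kern_err x y a b b1) as [Er Ei].
destruct (kern_decay x y) as [D1 D2]; destruct (kern_decay (x + a) (y + b)) as [D3 D4].
destruct (tkern_decay x y) as [D5 D6].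
assert (B1 := two_sided_comb _ _ _ _ _ _ _ _ _ _ _ D3 D1 D6 D5 Er).
assert (B2 := two_sided_comb _ _ _ _ _ _ _ _ _ _ _ D4 D2 D5 D6 Ei).
fold K Tr Ti in B1, B2; rewrite <- N2 in B1, B2.
unfold G, Csub, Cadd, Cmul; simpl fst; simpl snd.
apply Rle_trans with (1 := Cnorm_le_abs _ _).
match goal with |- Rabs ?u + Rabs ?v <= _ =>
  replace u with (two_sided (kern_re (x + a) (y + b)) - two_sided (kern_re x y) + a * Ti + b * Tr) by ring;
  replace v with (two_sided (kern_im (x + a) (y + b)) - two_sided (kern_im x y) + - a * Tr + b * Ti) by ring
end.
assert (4 * K * n <= eps).
{ assert (E : eps / (4 * K) * (4 * K) = eps) by (field; lra).
  assert (n * (4 * K) <= eps / (4 * K) * (4 * K)) by (apply Rmult_le_compat_r; lra); lra. }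
assert (4 * K * n * n <= eps * n) by (apply Rmult_le_compat_r; lra).
nra.
Qed.

(** * The mesh and the convergence of the scaled sums to G *)

Let gs (N : nat) : list R := apx_list mu Nb beta (S N).
Let h (N : nat) : R := proj1_sig (exists_step k m (gs N) N k0 m1).
Let w (N : nat) : nat -> R := weight k m (gs N) (h N).

Lemma h_pos N : 0 < h N.
Proof. exact (proj1 (proj2_sig (exists_step k m (gs N) N k0 m1))). Qed.

Lemma h_step N : qa N (h N * INR (S N)) - qa N (h N * INR N) = 2.
Proof. exact (proj2 (proj2_sig (exists_step k m (gs N) N k0 m1))). Qed.

(** The last increment equals 2 but is at least k h^(2 m) (2 N + 1). *)
Lemma h_small eps : 0 < eps -> exists N0, forall N, (N0 <= N)%nat -> h N < eps.
Proof.
intros e0; set (c := k * eps ^ (2 * m)).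
assert (c0 : 0 < c) by (apply Rmult_lt_0_compat; [lra|apply pow_lt; lra]).
destruct (nfloor_ex (/ c)) as [N0 [_ hN0]]; [apply Rlt_le, Rinv_0_lt_compat; lra|].
exists (S N0); intros N hN; apply Rnot_le_lt; intros he.
assert (hN' := le_INR _ _ hN); rewrite S_INR in hN'.
assert (st := qpol_step_lower k m (gs N) (h N) N k0 m1 (h_pos N)).
change (qpol k m (gs N)) with (qa N) in st; rewrite h_step in st.
assert (c <= k * h N ^ (2 * m)) by (apply Rmult_le_compat_l; [lra|apply pow_incr; lra]).
assert (n0 := pos_INR N).
assert (E : c * / c = 1) by (field; lra).
assert (c * / c < c * INR N) by (apply Rmult_lt_compat_l; lra).
assert (c * (2 * INR N + 1) <= k * h N ^ (2 * m) * (2 * INR N + 1)) by (apply Rmult_le_compat_r; lra).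
lra.
Qed.

Lemma qa_convex_incr N : convex_incr (qa N).
Proof. apply convex_incr_qpol; lra. Qed.

Lemma q_nonneg t : 0 <= q t.
Proof. assert (u := q_lower t); assert (v := main_term_nonneg t); lra. Qed.

(** An increment of 2 over a cell of vanishing length needs an unbounded slope, while on a bounded
    interval the approximants are Lipschitz uniformly in N. *)
Lemma h_large B : exists N0, forall N, (N0 <= N)%nat -> B <= h N * INR N.
Proof.
set (C := Rabs B + 3); assert (B0 := Rabs_pos B); assert (BB := Rle_abs B).
assert (q0 := q_nonneg C).
destruct (h_small (Rmin 1 (1 / (q C + 1)))) as [N0 hN0].
{ apply Rmin_pos; [lra|apply Rdiv_lt_0_compat; lra]. }
exists N0; intros N hN; specialize (hN0 N hN).
assert (h1 := Rlt_le_trans _ _ _ hN0 (Rmin_l _ _)); assert (h2 := Rlt_le_trans _ _ _ hN0 (Rmin_r _ _)).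
apply Rnot_lt_le; intros hB; assert (hp := h_pos N); assert (n0 := pos_INR N).
assert (a0 : 0 <= h N * INR N) by (apply Rmult_le_pos; lra).
assert (st := h_step N).
assert (e : h N * INR (S N) = h N * INR N + h N) by (rewrite S_INR; ring).
assert (l := convex_incr_lip (qa N) (h N * INR N) (h N * INR (S N)) (Rabs B + 2) (qa_convex_incr N)
  ltac:(lra) ltac:(lra)).
replace (Rabs B + 2 + 1) with C in l by (unfold C; ring).
assert (ql := qa_le_q N C).
replace (h N * INR (S N) - h N * INR N) with (h N) in l by lra.
assert (h N * qa N C <= h N * q C) by (apply Rmult_le_compat_l; lra).
assert (E : 1 / (q C + 1) * (q C + 1) = 1) by (field; lra).
assert (h N * (q C + 1) < 1 / (q C + 1) * (q C + 1)) by (apply Rmult_lt_compat_r; lra).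
lra.
Qed.

Lemma w_upper N j : (j <= N)%nat -> w N j <= exp (- qa N (h N * INR j)).
Proof. intros jN; apply (weight_upper k m (gs N) (h N) N k0 m1 (h_pos N) (h_step N) j jN). Qed.

Lemma w_pos N j : (j <= N)%nat -> 0 < w N j.
Proof. intros jN; apply (weight_pos k m (gs N) (h N) N k0 m1 (h_pos N) (h_step N) j jN). Qed.

Lemma w_close B eps : 0 < B -> 0 < eps -> exists N0, forall N j, (N0 <= N)%nat -> (j <= N)%nat ->
  h N * INR j <= B -> Rabs (w N j - exp (- q (h N * INR j))) <= eps.
Proof.
intros B0 e0; set (Q := q (B + 1) + 1).
assert (Q1 : 1 <= Q) by (assert (u := q_nonneg (B + 1)); unfold Q; lra).
assert (el := apx_err_lim B); apply is_lim_seq_Reals in el.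
destruct (el (eps / Q) ltac:(apply Rdiv_lt_0_compat; lra)) as [N1 hN1].
(* For a = h Q / 2, the first bound gives a <= 1/2 and the second 2 a Q = h Q^2 <= eps. *)
destruct (h_small (Rmin (/ Q) (eps / (Q * Q)))) as [N2 hN2].
{ apply Rmin_pos; [apply Rinv_0_lt_compat; lra|apply Rdiv_lt_0_compat; nra]. }
exists (N1 + N2)%nat; intros N j hN jN hj.
specialize (hN1 N ltac:(lia)); specialize (hN2 N ltac:(lia)).
assert (g1 := Rlt_le_trans _ _ _ hN2 (Rmin_l _ _)); assert (g2 := Rlt_le_trans _ _ _ hN2 (Rmin_r _ _)).
assert (hp := h_pos N); assert (j0 := pos_INR j).
set (t := h N * INR j) in *; assert (t0 : 0 <= t) by (apply Rmult_le_pos; lra).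
assert (qB : q t <= Q) by (assert (u := q_mono t (B + 1) ltac:(lra)); unfold Q; lra).
assert (qt0 := q_nonneg t).
assert (qat0 : 0 <= qa N t) by (assert (u := qa_lower N t); assert (v := main_term_nonneg t); lra).
assert (qat := qa_le_q N t).
assert (diff : q t - qa N t <= eps).
{ apply Rle_trans with (1 := q_sub_qa N t).
  assert (em : apx_err mu Nb beta s (S N) t <= apx_err mu Nb beta s (S N) B).
  { unfold apx_err; apply Rplus_le_compat.
    - apply Rmult_le_compat_r; [apply Rlt_le, Rinv_0_lt_compat, lt_0_INR; lia|].
      apply pow_incr; split; [apply Rmult_le_pos; [lra|apply pow2_ge_0]|].
      apply Rmult_le_compat_l; [lra|apply pow_incr; lra].
    - apply Rmult_le_compat_r; [|apply pow_incr; lra].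
      assert (u := growing_ineq _ _ (beta_sum_growing Nb beta) hs (S N)); lra. }
  unfold R_dist, Rdist in hN1; rewrite Rminus_0_r in hN1.
  assert (ep := Rle_lt_trans _ _ _ (Rle_abs _) hN1).
  assert (E : eps / Q * Q = eps) by (field; lra).
  assert (q t * apx_err mu Nb beta s (S N) t <= q t * (eps / Q)) by (apply Rmult_le_compat_l; lra).
  assert (0 < eps / Q) by (apply Rdiv_lt_0_compat; lra).
  assert (q t * (eps / Q) <= Q * (eps / Q)) by (apply Rmult_le_compat_r; lra).
  lra. }
set (a := h N * Q / 2).
assert (a2 : 0 <= a <= / 2).
{ assert (E : / Q * Q = 1) by (field; lra).
  assert (h N * Q <= / Q * Q) by (apply Rmult_le_compat_r; lra).
  assert (0 <= h N * Q) by (apply Rmult_le_pos; lra).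
  unfold a; lra. }
(* Q bounds the slope of the approximant on [0, B], so every half-step up to t is at most a. *)
assert (lo : exp (- ((1 + 2 * a) * qa N t)) <= w N j).
{ apply (weight_lower k m (gs N) (h N) k0 m1 (h_pos N)); [lra|].
  intros i ij; unfold half_step; change (qpol k m (gs N)) with (qa N).
  assert (i0 := pos_INR i).
  assert (ij' : INR (S i) <= INR j) by (apply le_INR; lia).
  assert (b1 : h N * INR (S i) <= t) by (apply Rmult_le_compat_l; lra).
  assert (b0 : 0 <= h N * INR i) by (apply Rmult_le_pos; lra).
  assert (e : h N * INR (S i) - h N * INR i = h N) by (rewrite S_INR; ring).
  assert (l := convex_incr_lip (qa N) (h N * INR i) (h N * INR (S i)) B (qa_convex_incr N)
    ltac:(lra) ltac:(lra)).
  rewrite e in l; assert (v := qa_le_q N (B + 1)).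
  assert (h N * qa N (B + 1) <= h N * Q) by (apply Rmult_le_compat_l; [lra|unfold Q; lra]).
  unfold a; lra. }
assert (up := w_upper N j jN); fold t in up.
assert (x1 := exp_neg_sub (qa N t) (q t) ltac:(lra)).
assert (x2 : 0 <= 2 * a * qa N t) by (apply Rmult_le_pos; lra).
assert (x3 := exp_neg_sub (qa N t) ((1 + 2 * a) * qa N t) ltac:(lra)).
assert (x4 : exp (- q t) <= exp (- qa N t)) by (apply exp_le_mono; lra).
assert (x5 : 2 * a * qa N t <= eps).
{ assert (2 * a * qa N t <= 2 * a * Q) by (apply Rmult_le_compat_l; lra).
  assert (E : eps / (Q * Q) * (Q * Q) = eps) by (field; lra).
  assert (h N * (Q * Q) <= eps / (Q * Q) * (Q * Q)) by (apply Rmult_le_compat_r; nra).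
  unfold a in *; lra. }
apply Rabs_le; lra.
Qed.


Lemma scaled_sum_lim (phi : R -> R) Y : continuity phi -> 0 <= Y ->
  (forall t, 0 <= t -> Rabs (phi t) <= 2 * exp (Y * t)) ->
  is_lim_seq (fun N => h N * psum (fun j => w N j * phi (h N * INR j)) N)
    (half_int (fun t => exp (- q t) * phi t)).
Proof.
intros cphi Y0 hphi.
set (M := 2 * decay_const k Y).
assert (dom : forall t v, 0 <= t -> k * t ^ (2 * m) <= v -> exp (- v) * Rabs (phi t) <= M * exp (- t)).
{ intros t v t0 hv; assert (d := main_term_decay k m Y t v k0 m1 t0 hv).
  assert (exp (- v) * Rabs (phi t) <= exp (- v) * (2 * exp (Y * t)))
    by (apply Rmult_le_compat_l; [apply Rlt_le, exp_pos|apply hphi, t0]).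
  unfold M; lra. }
apply (riemann_limit _ (fun N j => w N j * phi (h N * INR j)) h M).
- split; [assert (cq := continuity_q); cont|].
  intros t t0; rewrite Rabs_mult, (Rabs_pos_eq (exp _)) by (apply Rlt_le, exp_pos).
  apply dom; [exact t0|apply q_lower].
- exact h_pos.
- exact h_small.
- exact h_large.
- intros N j jN; rewrite Rabs_mult, (Rabs_pos_eq (w N j)) by (apply Rlt_le, w_pos, jN).
  assert (t0 : 0 <= h N * INR j) by (apply Rmult_le_pos; [apply Rlt_le, h_pos|apply pos_INR]).
  apply Rle_trans with (2 := dom _ _ t0 (qa_lower N _)).
  apply Rmult_le_compat_r; [apply Rabs_pos|apply w_upper, jN].
- intros B eps B0 e0; set (C := 2 * exp (Y * B)).
  assert (C0 : 0 < C) by (assert (u := exp_pos (Y * B)); unfold C; lra).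
  destruct (w_close B (eps / C) B0 ltac:(apply Rdiv_lt_0_compat; lra)) as [N0 hN0].
  exists N0; intros N j hN jN hj; specialize (hN0 N j hN jN hj).
  rewrite <- Rmult_minus_distr_r, Rabs_mult.
  assert (t0 : 0 <= h N * INR j) by (apply Rmult_le_pos; [apply Rlt_le, h_pos|apply pos_INR]).
  assert (pb : Rabs (phi (h N * INR j)) <= C).
  { apply Rle_trans with (1 := hphi _ t0); unfold C; apply Rmult_le_compat_l; [lra|].
    apply exp_le_mono, Rmult_le_compat_l; lra. }
  replace eps with (eps / C * C) by (field; lra).
  apply Rmult_le_compat; auto; apply Rabs_pos.
Qed.

Lemma cosh_sinh_exp_bound y t : 0 <= t ->
  cosh (y * t) <= exp (Rabs y * t) /\ Rabs (sinh (y * t)) <= exp (Rabs y * t).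
Proof.
intros t0; unfold cosh, sinh.
assert (p1 := exp_pos (y * t)); assert (p2 := exp_pos (- (y * t))).
assert (exp (y * t) <= exp (Rabs y * t)).
{ apply exp_le_mono, Rmult_le_compat_r; [lra|apply Rle_abs]. }
assert (exp (- (y * t)) <= exp (Rabs y * t)).
{ apply exp_le_mono; rewrite <- Ropp_mult_distr_l_reverse; apply Rmult_le_compat_r; [lra|].
  rewrite <- Rabs_Ropp; apply Rle_abs. }
split; [lra|apply Rabs_le; lra].
Qed.

Lemma G_re_half x y :
  fst (G (x, y)) = half_int (fun t => exp (- q t) * (2 * (cosh (y * t) * cos (x * t)))).
Proof.
apply half_int_ext; intros t; simpl fst; simpl snd; unfold kern_re.
rewrite q_even; unfold Rminus; rewrite !exp_plus.
replace (x * - t) with (- (x * t)) by ring; rewrite cos_neg; unfold cosh.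
replace (- (y * - t)) with (y * t) by ring; field.
Qed.

Lemma G_im_half x y :
  snd (G (x, y)) = half_int (fun t => exp (- q t) * - (2 * (sinh (y * t) * sin (x * t)))).
Proof.
apply half_int_ext; intros t; simpl fst; simpl snd; unfold kern_im.
rewrite q_even; unfold Rminus; rewrite !exp_plus.
replace (x * - t) with (- (x * t)) by ring; rewrite sin_neg; unfold sinh.
replace (- (y * - t)) with (y * t) by ring; field.
Qed.

Lemma psum_opp f n : - psum f n = psum (fun j => - f j) n.
Proof. induction n as [|n IH]; simpl; [lra|]; rewrite <- IH; ring. Qed.

Lemma cos_sum_re_lim x y :
  is_lim_seq (fun N => h N * cos_sum_re N (w N) (h N * x) (h N * y)) (fst (G (x, y))).
Proof.
rewrite G_re_half.
set (phi := fun t => 2 * (cosh (y * t) * cos (x * t))).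
apply (is_lim_seq_ext (fun N => h N + h N * psum (fun j => w N j * phi (h N * INR j)) N)).
{ intros N; unfold cos_sum_re; change (w N 0%nat) with 1.
  rewrite Rmult_plus_distr_l, Rmult_1_r; f_equal; f_equal; apply psum_ext; intros j _.
  unfold phi; do 3 f_equal; f_equal; ring. }
(* The central term j = 0 contributes only h, which tends to 0. *)
rewrite <- (Rplus_0_l (half_int _)).
apply is_lim_seq_plus'.
- apply is_lim_seq_Reals; intros eps e0; destruct (h_small eps e0) as [N0 hN0].
  exists N0; intros N hN; unfold R_dist, Rdist; rewrite Rminus_0_r, Rabs_pos_eq by (apply Rlt_le, h_pos).
  apply hN0, hN.
- apply (scaled_sum_lim phi (Rabs y)); [unfold phi; cont|apply Rabs_pos|].
  intros t t0; destruct (cosh_sinh_exp_bound y t t0) as [b _].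
  unfold phi; rewrite !Rabs_mult, (Rabs_pos_eq 2), (Rabs_pos_eq (cosh _)) by (try apply Rlt_le, cosh_pos; lra).
  assert (c : Rabs (cos (x * t)) <= 1) by (apply Rabs_le, COS_bound).
  assert (cp := cosh_pos (y * t)); assert (c0 := Rabs_pos (cos (x * t))); nra.
Qed.

Lemma cos_sum_im_lim x y :
  is_lim_seq (fun N => h N * cos_sum_im N (w N) (h N * x) (h N * y)) (snd (G (x, y))).
Proof.
rewrite G_im_half.
set (phi := fun t => - (2 * (sinh (y * t) * sin (x * t)))).
apply (is_lim_seq_ext (fun N => h N * psum (fun j => w N j * phi (h N * INR j)) N)).
{ intros N; unfold cos_sum_im; rewrite psum_opp.
  f_equal; apply psum_ext; intros j _; unfold phi.
  replace (y * (h N * INR j)) with (INR j * (h N * y)) by ring.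
  replace (x * (h N * INR j)) with (INR j * (h N * x)) by ring; ring. }
apply (scaled_sum_lim phi (Rabs y)); [unfold phi; cont|apply Rabs_pos|].
intros t t0; destruct (cosh_sinh_exp_bound y t t0) as [_ b].
unfold phi; rewrite Rabs_Ropp, !Rabs_mult, (Rabs_pos_eq 2) by lra.
assert (c : Rabs (sin (x * t)) <= 1) by (apply Rabs_le, SIN_bound).
assert (cp := Rabs_pos (sinh (y * t))); assert (c0 := Rabs_pos (sin (x * t))); nra.
Qed.

(** * Passing to the limit: zeros of G *)

Lemma G_0_pos : 0 < fst (G (0, 0)).
Proof.
rewrite G_re_half; set (f := fun t => exp (- q t) * (2 * (cosh (0 * t) * cos (0 * t)))).
assert (fE : forall t, f t = 2 * exp (- q t)).
{ intros t; unfold f; rewrite !Rmult_0_l, cos_0, cosh_0; ring. }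
assert (cf : continuity f) by (assert (cq := continuity_q); unfold f; cont).
assert (df : exp_decay (2 * decay_const k 0) f).
{ split; [exact cf|]; intros t t0; rewrite fE, Rabs_pos_eq by (assert (u := exp_pos (- q t)); lra).
  assert (d := main_term_decay k m 0 t (q t) k0 m1 t0 (q_lower t)).
  rewrite Rmult_0_l, exp_0, Rmult_1_r in d; lra. }
assert (L := half_int_lim _ _ df).
(* The integrand decreases on [0, 1], so its value at 1 bounds the integral from below. *)
apply Rlt_le_trans with (2 * exp (- q 1)); [assert (u := exp_pos (- q 1)); lra|].
refine (is_lim_seq_le_loc (fun _ => 2 * exp (- q 1)) _ (2 * exp (- q 1)) (half_int f) _ (is_lim_seq_const _) L).
exists 1%nat; intros n hn; assert (n1 := le_INR _ _ hn); simpl INR in n1.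
rewrite <- (RInt_Chasles_R f 0 1 (INR n)) by exact cf.
assert (i1 : 2 * exp (- q 1) <= RInt f 0 1).
{ replace (2 * exp (- q 1)) with (RInt (fun _ => 2 * exp (- q 1)) 0 1)
    by (rewrite RInt_const; unfold scal; simpl; unfold mult; simpl; ring).
  apply RInt_le; [lra|apply ex_RInt_const|apply continuity_ex_RInt, cf|].
  intros t ht; rewrite fE; apply Rmult_le_compat_l; [lra|apply exp_le_mono].
  assert (u := q_mono t 1 ltac:(lra)); lra. }
assert (i2 : 0 <= RInt f 1 (INR n)).
{ apply RInt_ge_0; [exact n1|apply continuity_ex_RInt, cf|].
  intros t _; rewrite fE; assert (u := exp_pos (- q t)); lra. }
lra.
Qed.

(** For y <> 0 the limit inequality is |G(z)|^4 >= G(0)^4 exp (- K ((G(i) / G(0))^2 - 1)), with K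
    depending only on z; its right side is positive by [G_0_pos]. *)
Lemma G_real_zeros z : G z = (0, 0) -> snd z = 0.
Proof.
destruct z as [x y]; intros Gz; simpl snd.
destruct (Req_dec y 0) as [|y0]; [assumption|exfalso].
set (K := 8 * (1 + 4 * x ^ 2 / y ^ 2) * (9 / 4 * y ^ 2 + x ^ 2)).
set (c := fun N => h N * cos_sum_re N (w N) (h N * 0) (h N * 0)).
set (d := fun N => h N * cos_sum_re N (w N) (h N * 0) (h N * 1)).
set (re := fun N => h N * cos_sum_re N (w N) (h N * x) (h N * y)).
set (im := fun N => h N * cos_sum_im N (w N) (h N * x) (h N * y)).
assert (Lc : is_lim_seq c (fst (G (0, 0)))) by apply cos_sum_re_lim.
assert (Ld : is_lim_seq d (fst (G (0, 1)))) by apply cos_sum_re_lim.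
assert (Lre : is_lim_seq re 0) by (assert (l := cos_sum_re_lim x y); rewrite Gz in l; exact l).
assert (Lim : is_lim_seq im 0) by (assert (l := cos_sum_im_lim x y); rewrite Gz in l; exact l).
assert (g0 := G_0_pos); set (g := fst (G (0, 0))) in *; set (g1 := fst (G (0, 1))) in *.
assert (pow_lim : forall u l n, is_lim_seq u (Finite l) -> is_lim_seq (fun N => u N ^ n) (l ^ n)).
{ intros u l n hu; apply (is_lim_seq_continuous (fun t => t ^ n) u l); [|exact hu].
  apply derivable_continuous_pt, derivable_pt_pow. }
assert (LL : is_lim_seq (fun N => c N ^ 4 * exp (- (K * ((d N / c N) ^ 2 - 1))))
               (g ^ 4 * exp (- (K * ((g1 / g) ^ 2 - 1))))).
{ apply is_lim_seq_mult'; [apply pow_lim, Lc|].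
  apply (is_lim_seq_continuous (fun t => exp (- (K * (t - 1)))) (fun N => (d N / c N) ^ 2)).
  - assert (ct : continuity (fun t => exp (- (K * (t - 1))))) by cont; apply ct.
  - apply pow_lim, is_lim_seq_div'; [exact Ld|exact Lc|lra]. }
assert (LR : is_lim_seq (fun N => (re N ^ 2 + im N ^ 2) ^ 2) ((0 ^ 2 + 0 ^ 2) ^ 2)).
{ apply pow_lim, is_lim_seq_plus'; apply pow_lim; assumption. }
set (D := 1 + Rabs x + Rabs y).
assert (x0 := Rabs_pos x); assert (yp := Rabs_pos y).
destruct (h_small (/ D) ltac:(apply Rinv_0_lt_compat; unfold D; lra)) as [N0 hN0].
assert (le : Rbar_le (g ^ 4 * exp (- (K * ((g1 / g) ^ 2 - 1)))) ((0 ^ 2 + 0 ^ 2) ^ 2)).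
{ apply (is_lim_seq_le_loc _ _ _ _) with (2 := LL) (3 := LR).
  exists N0; intros N hN; specialize (hN0 N hN); assert (hp := h_pos N).
  assert (hD : h N * D <= 1).
  { assert (E : / D * D = 1) by (field; unfold D; lra).
    assert (h N * D < / D * D) by (apply Rmult_lt_compat_r; [unfold D; lra|exact hN0]); lra. }
  assert (hx : h N * Rabs x <= 1) by (unfold D in hD; nra).
  assert (hy : h N * Rabs y <= 1) by (unfold D in hD; nra).
  assert (B := cos_sum_lower_bound k m (gs N) (h N) N (w N) x y k0 m1 hp (fun j jN => w_pos N j jN)
    (weight_last k m (gs N) (h N) N (h_step N))
    (fun j _ => weight_rec k m (gs N) (h N) k0 m1 hp j) y0 hx hy).
  fold K in B.
  unfold c, d, re, im; rewrite !Rmult_0_r, !Rmult_1_r.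
  set (C0 := cos_sum_re N (w N) 0 0) in *; set (C1 := cos_sum_re N (w N) 0 (h N)) in *.
  assert (C0p : 0 < C0) by (apply cos_sum_re_pos; intros j jN; apply w_pos, jN).
  replace (h N * C1 / (h N * C0)) with (C1 / C0) by (field; lra).
  rewrite !Rpow_mult_distr.
  replace ((h N ^ 2 * cos_sum_re N (w N) (h N * x) (h N * y) ^ 2 +
    h N ^ 2 * cos_sum_im N (w N) (h N * x) (h N * y) ^ 2) ^ 2) with
    (h N ^ 4 * (cos_sum_re N (w N) (h N * x) (h N * y) ^ 2 +
    cos_sum_im N (w N) (h N * x) (h N * y) ^ 2) ^ 2) by ring.
  (* Both sides of the bound for the unscaled sums are multiplied by h^4. *)
  rewrite Rmult_assoc; apply Rmult_le_compat_l; [apply pow_le; lra|exact B]. }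
simpl in le.
assert (0 < g ^ 4 * exp (- (K * ((g1 / g) ^ 2 - 1))))
  by (apply Rmult_lt_0_compat; [apply pow_lt; lra|apply exp_pos]).
simpl in *; lra.
Qed.

End Main.

Theorem theorem1 (k mu : R) (m : nat) (Nb : option nat) (beta : nat -> R)
    (q : R -> R)
    (hk : k > 0) (hmu : mu >= 0) (hm : (1 <= m)%nat)
    (hbeta : admissible_seq Nb beta)
    (hq : is_q k mu m Nb beta q)
    (hgrowth : exists T alpha : R, T > 0 /\ alpha > 0 /\
        forall t : R, t >= T -> q t > Rpower t (2 + alpha)) :
  exists G : Cx -> Cx,
    (forall z : Cx, fourier_integral q z (G z)) /\
    entire G /\
    (forall z : Cx, G z = (0, 0) -> snd z = 0).
Proof.
destruct hbeta as [hb [s hs]].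
(* [sum_f_R0] includes its last index and [beta_sum] does not, hence the shift by one. *)
assert (hs' : Un_cv (beta_sum Nb beta) s).
{ apply is_lim_seq_Reals, is_lim_seq_incr_1.
  apply is_lim_seq_Reals in hs; revert hs; apply is_lim_seq_ext; intros n.
  induction n as [|n IH]; [simpl; ring|]; rewrite tech5, IH; reflexivity. }
exists (G q); split; [|split].
- intros z; eapply G_fourier; eassumption.
- eapply G_entire; eassumption.
- intros z; eapply G_real_zeros; eassumption.
Qed.
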